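(* Let $0\le s\le r$, let $\lambda\in\widehat A_{r-s}$ and $\nu\in\widehat A_r$, and let $\mathsf t^\lambda$ be any maximal element of $\mathrm{Std}_{r-s}(\lambda)$ in the dominance order. Then the $R$-module $$\Delta^R_s(\nu\setminus\lambda)=\mathrm{Span}_R\big\{u_{\mathsf u}u_{\mathsf t^\lambda}+A^{\rhd\nu\setminus\lambda}_{s,r}\ \big|\ \mathsf u\in\mathrm{Std}_s(\nu\setminus\lambda)\big\}$$ carries the structure of a (right) $A_s$-module, under the identification $1\times A_s\subseteq A_{r-s}\times A_s\subseteq A_r$ (the action being the one induced by right multiplication in $A_r$).
   Context: **Cellular algebras.** Let $R$ be an integral domain with field of fractions $\mathbb F$. A cellular algebra over $R$ is a tuple $(A,*,\widehat A,\trianglerighteq,\mathscr A)$ where $A$ is a unital $R$-algebra with an algebra involution $*$ (an $R$-linear anti-automorphism with $(x^* )^*=x$); $(\widehat A,\trianglerighteq)$ is a finite poset and for each $\lambda\in\widehat A$ there is a finite set $\mathrm{Std}(\lambda)$; $\mathscr A=\{c^\lambda_{\mathsf s\mathsf t}\mid\lambda\in\widehat A,\ \mathsf s,\mathsf t\in\mathrm{Std}(\lambda)\}$ is an $R$-basis of $A$ such that (a) for $\lambda\in\widehat A$, $\mathsf t\in\mathrm{Std}(\lambda)$, $a\in A$ there are $r(a;\mathsf t,\mathsf v)\in R$ with $c^\lambda_{\mathsf s\mathsf t}a\equiv\sum_{\mathsf v}r(a;\mathsf t,\mathsf v)c^\lambda_{\mathsf s\mathsf v}\bmod A^{\rhd\lambda}$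 for all $\mathsf s\in\mathrm{Std}(\lambda)$, where $A^{\rhd\lambda}$ is the $R$-span of all $c^\mu_{\mathsf p\mathsf q}$ with $\mu\rhd\lambda$; (b) $(c^\lambda_{\mathsf s\mathsf t})^*=c^\lambda_{\mathsf t\mathsf s}$. The cell module $\Delta^R(\lambda)$ is the right $A$-module with $R$-basis $\{c^\lambda_{\mathsf s\mathsf t}+A^{\rhd\lambda}\mid\mathsf t\in\mathrm{Std}(\lambda)\}$ for any fixed $\mathsf s$. $A$ is cyclic cellular if every cell module is cyclic, and generically semisimple if $A^{\mathbb F}=A\otimes_R\mathbb F$ is semisimple. **Strongly coherent towers.** Let $(A_k)_{k\ge0}$ be an increasing sequence $R=A_0\subseteq A_1\subseteq\cdots$ of cyclic cellular algebras over $R$ with unital inclusions and compatible involutions; cell modules of $A_k$ are $\Delta^R_k(\lambda)$, $\lambda\in\widehat A_k$. An order preserving cell-filtration of a right module $M$ is a filtration $0=M_0\subseteq\cdots\subseteq M_p=M$ with $M_i/M_{i-1}$ isomorphic to a cell module labelled by $\lambda^{(i)}$ and $\lambda^{(i)}\rhd\lambda^{(i+1)}$ for all $i$. The tower is strongly coherent if all modules induced from cell modules of $A_k$ to $A_{k+1}$, and all restrictions of cell modules of $A_{k+1}$ to $A_k$, have order preserving cell-filtrations. The branching graph $\widehat A$ has vertex set $\widehat A_k$ on level $k$, and an edge $\lambda\to\mu$ ($\lambda\in\widehat A_k$, $\mu\in\widehat A_{k+1}$) iff $\Delta_k^R(\lambda)$ appears in the cell-filtration of the restriction of $\Delta^R_{k+1}(\mu)$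 to $A_k$. **Towers of diagram algebras.** Let $(A_k)_{k\ge0}$ and $(H_k)_{k\ge0}$ be two increasing towers of $R$-algebras with common multiplicative identity. $(A_k)$ is a tower of diagram algebras (obtained by reflections from $(H_k)$) if: (1) there are algebra involutions $*$ on $\bigcup_kA_k$ and $\bigcup_kH_k$ preserving each $A_k$, resp. $H_k$; (2) $A_0=H_0=R$ and $A_1=H_1$ as algebras with involution; (3) for $k\ge2$, $A_k$ contains an element $e_{k-1}=e_{k-1}^*$ with $e_{k-1}^2=\delta e_{k-1}$ for some nonzero $\delta\in R$, and $A_k/(A_ke_{k-1}A_k)\cong H_k$ as algebras with involution; (4) for $k\ge1$, $e_k$ commutes with $A_{k-1}$ and $e_kA_ke_k\subseteq A_{k-1}e_k$; (5) for $k\ge1$, $A_{k+1}e_k=A_ke_k$ and $x\mapsto xe_k$ is injective from $A_k$ to $A_ke_k$; (6) for $k\ge2$, $e_{k-1}\in A_{k+1}e_kA_{k+1}$; (7) $(H_k)$ is a strongly coherent tower of cellular algebras; (8) for $k\ge2$, $e_{k-1}A_ke_{k-1}A_k=e_{k-1}A_k$; (9) each $H_k$ is cyclic cellular; (10) each $A_k^{\mathbb F}=A_k\otimes_R\mathbb F$ is split semisimple. It is known that then $(A_k)$ is a strongly coherent tower of generically semisimple cyclic cellular algebras. **Standing assumptions.** $(A_k)_{k\ge0}$ is a tower of diagram algebras, equipped with a family of (additive or multiplicative) Jucys–Murphy elements: elements $L_k\in A_k$ ($k\ge1$), $*$-invariant, with $L_k$ commuting with $A_{k-1}$, such that for every $\lambda\in\widehat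 A_k$ the element $L_1+\cdots+L_k$ (additive case), respectively $L_1\cdots L_k$ with all $L_i$ invertible (multiplicative case), acts on $\Delta_k^R(\lambda)$ by a scalar $d(\lambda)\in R$. For $0\le s\le r$ there is a fixed injective unital algebra homomorphism $A_{r-s}\otimes_RA_s\to A_r$ restricting on $A_{r-s}\otimes1$ to the tower inclusion; its image is written $A_{s,r}=A_{r-s}\times A_s\subseteq A_r$, and $1\times A_s$ is the image of $1\otimes A_s$. **Tableaux.** For $\lambda\in\widehat A_{r-s}$, $\nu\in\widehat A_r$, $\mathrm{Std}_s(\nu\setminus\lambda)$ is the set of paths of length $s$ from $\lambda$ to $\nu$ in $\widehat A$; $\mathrm{Std}_r(\nu)$ is the set of paths $\mathsf t=(\mathsf t(0)\to\cdots\to\mathsf t(r)=\nu)$ starting on level $0$. Dominance order on paths between the same levels: $\mathsf s\trianglerighteq\mathsf t$ iff $\mathsf s(k)\trianglerighteq\mathsf t(k)$ on every level $k$. **Murphy basis (known).** There are elements (branching coefficients) $d_{\lambda\to\mu},u_{\lambda\to\mu}\in A_{k+1}$, one pair for each edge $\lambda\to\mu$ from level $k$ to level $k+1$, such that for each $r$, with $d_{\mathsf s}=d_{\mathsf s(0)\to\mathsf s(1)}\cdots d_{\mathsf s(r-1)\to\mathsf s(r)}$ and $u_{\mathsf t}=u_{\mathsf t(r-1)\to\mathsf t(r)}\cdots u_{\mathsf t(0)\to\mathsf t(1)}$, the set $\{d_{\mathsf s}u_{\mathsf t}\mid\mathsf s,\mathsf t\in\mathrm{Std}_r(\nu),\nu\in\widehat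 A_r\}$ is a cellular basis of $A_r$; moreover $u_{\mathsf t}\in A_r^{\trianglerighteq\nu}$ for $\mathsf t\in\mathrm{Std}_r(\nu)$ (the $R$-span of the cellular basis elements labelled by $\mu\trianglerighteq\nu$), and $\Delta^R_r(\nu)$ is identified with the right $A_r$-module with $R$-basis $\{u_{\mathsf t}+A_r^{\rhd\nu}\mid\mathsf t\in\mathrm{Std}_r(\nu)\}$. Such a choice is fixed. For a skew path $\mathsf u\in\mathrm{Std}_s(\nu\setminus\lambda)$, $u_{\mathsf u}$ is the analogous product of the $u$-coefficients along its edges, last edge leftmost, so $u_{\mathsf u}u_{\mathsf t}$ is the $u$-element of the concatenated path. **Notation.** $A^{\rhd\nu\setminus\lambda}_{s,r}$ is the $R$-span in $A_r$ of $\{d_{\mathsf s}u_{\mathsf t}\mid\mathsf s,\mathsf t\in\mathrm{Std}_r(\mu),\ \mu\rhd\nu\}\cup\{u_{\mathsf t}\mid\mathsf t\in\mathrm{Std}_r(\nu),\ \mathsf t(r-s)\rhd\lambda\}$. *)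

(* Defs.v *)
From HB Require Import structures.
From mathcomp Require Import all_boot all_order all_algebra.
From mathcomp Require Import boolp classical_sets.

Set Implicit Arguments.
Unset Strict Implicit.
Unset Printing Implicit Defensive.

Import Order.TTheory GRing.Theory.
Local Open Scope classical_set_scope.
Local Open Scope ring_scope.

Definition alg_involution (R : comNzRingType) (B : lalgType R) (s : B -> B) : Prop :=
  [/\ forall (r : R) x y, s (r *: x + y) = r *: s x + s y,
      forall x y, s (x * y) = s y * s x
    & forall x, s (s x) = x].

Definition Rspan (R : pzRingType) (V : lmodType R) (S : set V) : set V :=
  [set x | exists n (a : 'I_n -> R) (v : 'I_n -> V),
     (forall i, S (v i)) /\ x = \sum_i a i *: v i].

Definition is_basis (R : pzRingType) (V : lmodType R) (I : finType) (b : I -> V) :=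
  forall x, exists! f : {ffun I -> R}, x = \sum_i f i *: b i.

(* Right B-modules are left modules over the converse ring B^c. *)
Definition ract (B : pzRingType) (M : lmodType B^c) (x : M) (a : B) : M :=
  (a : B^c) *: x.

(* [pi] induces an isomorphism P / N -> D commuting with the operators in B. *)
Record subquotient_iso (W D : zmodType) (B : Type)
    (actW : W -> B -> W) (actD : D -> B -> D) (P N : set W) (pi : W -> D) : Prop := {
  sq_sub : N `<=` P;
  sq_stable : forall x a, P x -> P (actW x a);
  sq_add : forall x y, P x -> P y -> pi (x + y) = pi x + pi y;
  sq_act : forall x a, P x -> pi (actW x a) = actD (pi x) a;
  sq_onto : forall d, exists2 x, P x & pi x = d;
  sq_ker : forall x, P x -> (pi x = 0 <-> N x) }.

Section Tensor.
Variables (M N : zmodType) (B : Type) (rM : M -> B -> M) (lN : B -> N -> N).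

Definition balanced (G : zmodType) (f : M -> N -> G) : Prop :=
  [/\ forall n, {morph f^~ n : x y / x + y},
      forall m, {morph f m : x y / x + y}
    & forall m b n, f (rM m b) n = f m (lN b n)].

(* (T, tau) is the tensor product of M and N over B. *)
Definition is_tensor (T : zmodType) (tau : M -> N -> T) : Prop :=
  balanced tau /\
  forall (G : zmodType) (f : M -> N -> G), balanced f ->
    exists g : {additive T -> G}, (forall m n, g (tau m n) = f m n) /\
      forall g' : {additive T -> G}, (forall m n, g' (tau m n) = f m n) -> g' =1 g.

End Tensor.

(* M as a B-module via f. *)
Definition restrict (B B' : nzRingType) (f : {rmorphism B -> B'})
    (M : lmodType B'^c) : Type := M.

Section Restriction.
Variables (B B' : nzRingType) (f : {rmorphism B -> B'}) (M : lmodType B'^c).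

Local Notation restrict := (restrict f M).
HB.instance Definition _ := GRing.Zmodule.on restrict.

Definition restrict_scale (a : B^c) (x : restrict) : restrict := ract (x : M) (f a).

Fact restrict_scaleA a b v :
  restrict_scale a (restrict_scale b v) = restrict_scale (a * b) v.
Proof. by rewrite /restrict_scale /ract scalerA; congr (_ *: _); exact/esym/(rmorphM f). Qed.
Fact restrict_scale1 : left_id 1 restrict_scale.
Proof. by move=> v; rewrite /restrict_scale /ract (rmorph1 f) (scale1r (v : M)). Qed.
Fact restrict_scaleDr : right_distributive restrict_scale +%R.
Proof. by move=> a u v; rewrite /restrict_scale /ract (scalerDr _ (u : M)). Qed.
Fact restrict_scaleDl v : {morph restrict_scale^~ v : a b / a + b}.
Proof. by move=> a b; rewrite /restrict_scale /ract -scalerDl; congr (_ *: _); exact: (rmorphD f). Qed.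

HB.instance Definition _ := GRing.Zmodule_isLmodule.Build B^c restrict
  restrict_scaleA restrict_scale1 restrict_scaleDr restrict_scaleDl.

End Restriction.

(* T is the module M (x)_B B' induced from M along f. *)
Definition is_induced (B B' : nzRingType) (f : {rmorphism B -> B'})
    (M : lmodType B^c) (T : lmodType B'^c) (tau : M -> B' -> T) : Prop :=
  is_tensor (@ract B M) (fun b x => f b * x) tau /\
  forall m x a, ract (tau m x) a = tau m (x * a).

Section Cellular.
Variables (R : idomainType) (B : algType R).
Variables (disp : Order.disp_t) (hat : finPOrderType disp) (Std : hat -> finType).

Definition span_above (c : forall la, Std la -> Std la -> B) (la : hat) : set B :=
  Rspan [set x | exists mu (p q : Std mu), (la < mu)%O /\ x = c mu p q].

Record cellular := Cellular {
  star : B -> B;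
  star_invol : alg_involution star;
  cbas : forall la, Std la -> Std la -> B;
  cbas_basis : is_basis (fun i : {la : hat & (Std la * Std la)%type} =>
                           cbas (tagged i).1 (tagged i).2);
  ccoef : forall la, B -> Std la -> Std la -> R;
  cbasM : forall la a (s t : Std la),
    span_above cbas la (cbas s t * a - \sum_v ccoef a t v *: cbas s v);
  star_cbas : forall la (s t : Std la), star (cbas s t) = cbas t s }.

End Cellular.

Section SpanTheory.
Variables (R : nzRingType) (V : lmodType R).
Implicit Types (S : set V) (x y : V).

Lemma Rspan0 S : Rspan S 0.
Proof. by exists 0%N, (fun=> 0), (fun=> 0); split=> [[]|] //; rewrite big_ord0. Qed.

Lemma RspanZD S r x y : Rspan S x -> Rspan S y -> Rspan S (r *: x + y).
Proof.
move=> [n [a [v [Sv ->]]]] [m [b [w [Sw ->]]]].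
exists (n + m)%N, (fun i => match split i with inl j => r * a j | inr j => b j end),
  (fun i => match split i with inl j => v j | inr j => w j end); split.
  by move=> i; case: (split i).
rewrite big_split_ord scaler_sumr; congr (_ + _); apply: eq_bigr => i _.
  by rewrite (_ : split _ = inl i) ?scalerA //; exact: (unsplitK (inl i)).
by rewrite (_ : split _ = inr i) //; exact: (unsplitK (inr i)).
Qed.

Lemma RspanD S x y : Rspan S x -> Rspan S y -> Rspan S (x + y).
Proof. by move=> Sx Sy; rewrite -[x]scale1r; apply: RspanZD. Qed.

Lemma RspanZ S r x : Rspan S x -> Rspan S (r *: x).
Proof. by move=> Sx; rewrite -[_ *: _]addr0; apply: RspanZD => //; apply: Rspan0. Qed.

Lemma RspanN S x : Rspan S x -> Rspan S (- x).
Proof. by move=> Sx; rewrite -scaleN1r; apply: RspanZ. Qed.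

Lemma Rspan_mem S x : S x -> Rspan S x.
Proof.
by move=> Sx; exists 1%N, (fun=> 1), (fun=> x); split=> //; rewrite big_ord1 scale1r.
Qed.

Lemma Rspan_ind S (P : set V) : P 0 ->
  (forall r x y, S x -> P y -> P (r *: x + y)) -> Rspan S `<=` P.
Proof.
move=> P0 PS x [n [a [v [Sv ->]]]].
by elim/big_rec: _ => [//|i y _ Py]; apply: PS.
Qed.

Lemma Rspan_sum S (I : finType) (f : I -> V) :
  (forall i, Rspan S (f i)) -> Rspan S (\sum_i f i).
Proof. by move=> H; elim/big_rec: _ => [|i x _]; [apply: Rspan0 | apply: RspanD]. Qed.

End SpanTheory.

(* The cell module Delta(la): the coordinate vector f stands for
   \sum_t f t * (c_{s t} + A^{> la}), on which a acts through [ccoef]. *)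
Definition cell_module (R : idomainType) (B : algType R) (disp : Order.disp_t)
    (hat : finPOrderType disp) (Std : hat -> finType)
    (C : cellular B Std) (la : hat) : Type := {ffun Std la -> R}.

Section CellModule.
Variables (R : idomainType) (B : algType R).
Variables (disp : Order.disp_t) (hat : finPOrderType disp) (Std : hat -> finType).
Variables (C : cellular B Std) (la : hat).

Lemma span_aboveM x a : span_above (cbas C) la x -> span_above (cbas C) la (x * a).
Proof.
apply: (Rspan_ind (P := [set x | span_above (cbas C) la (x * a)])) => /=.
  by rewrite mul0r; apply: Rspan0.
move=> r _ y [mu [p [q [lt_mu ->]]]] IH.
rewrite mulrDl -scalerAl; apply: RspanZD => //.
rewrite -[_ * _](subrK (\sum_v ccoef C a q v *: cbas C p v)).
apply: RspanD; last first.
  apply: Rspan_sum => v; apply/RspanZ/Rspan_mem; by exists mu, p, v.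
have := cbasM C a p q; apply: Rspan_ind; first exact: Rspan0.
move=> k _ z [nu [p' [q' [lt_nu ->]]]] IHz; apply: RspanZD => //.
by apply: Rspan_mem; exists nu, p', q'; split=> //; apply: lt_trans lt_nu.
Qed.

Let bas (i : {la : hat & (Std la * Std la)%type}) := cbas C (tagged i).1 (tagged i).2.

Lemma span_above_support x : span_above (cbas C) la x ->
  exists2 f : {ffun {la : hat & (Std la * Std la)%type} -> R},
    x = \sum_i f i *: bas i & forall p, f (Tagged _ (p : Std la * Std la)) = 0.
Proof.
apply: (Rspan_ind (P := [set x |
  exists2 f : {ffun {la : hat & (Std la * Std la)%type} -> R},
    x = \sum_i f i *: bas i & forall p, f (Tagged _ (p : Std la * Std la)) = 0])).
  exists [ffun=> 0]; last by move=> p; rewrite ffunE.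
  by rewrite big1 // => i _; rewrite ffunE scale0r.
move=> r _ y [mu [p [q [lt_mu ->]]]] [f -> f0].
pose j := Tagged (fun la => (Std la * Std la)%type) (p, q).
exists [ffun i => r * (i == j)%:R + f i]; last first.
  move=> p'; rewrite ffunE f0 addr0; case: eqP => [E|]; last by rewrite mulr0.
  by have := congr1 (@tag _ _) E; rewrite /= => E'; rewrite E' ltxx in lt_mu.
under [RHS]eq_bigr do rewrite ffunE scalerDl.
rewrite big_split /=; congr (_ + _).
rewrite (bigD1 j) //= eqxx mulr1 big1 ?addr0 // => i /negbTE ->.
by rewrite mulr0 scale0r.
Qed.

Lemma span_above_indep (s : Std la) (g : Std la -> R) :
  span_above (cbas C) la (\sum_v g v *: cbas C s v) -> forall v, g v = 0.
Proof.
move=> /span_above_support [f fE f0] v.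
pose h i : R := \sum_w g w * (i == Tagged (fun la => (Std la * Std la)%type) (s, w))%:R.
have hE : \sum_w g w *: cbas C s w = \sum_i [ffun i => h i] i *: bas i.
  under [RHS]eq_bigr do rewrite ffunE /h scaler_suml.
  rewrite exchange_big; apply: eq_bigr => w _.
  rewrite (bigD1 (Tagged (fun la => (Std la * Std la)%type) (s, w))) //=.
  rewrite eqxx mulr1 big1 ?addr0 // => i /negbTE ->.
  by rewrite mulr0 scale0r.
have [f' [_ uniq_f']] := cbas_basis C (\sum_v g v *: cbas C s v).
have E : f = [ffun i => h i] by rewrite -(uniq_f' _ fE) -(uniq_f' _ hE).
have := f0 (s, v); rewrite E ffunE /h (bigD1 v) //= eqxx mulr1 big1 ?addr0 // => w.
by rewrite eq_Tagged /= xpair_eqE eqxx /= eq_sym => /negbTE ->; rewrite mulr0.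
Qed.

Lemma ccoef_uniq a (s t : Std la) (g : Std la -> R) :
  span_above (cbas C) la (cbas C s t * a - \sum_v g v *: cbas C s v) ->
  forall v, ccoef C a t v = g v.
Proof.
move=> Hg v; apply/eqP; rewrite -subr_eq0; apply/eqP.
apply: (@span_above_indep s (fun v => ccoef C a t v - g v)).
under eq_bigr do rewrite scalerBl.
rewrite sumrB -(subrKA (cbas C s t * a)); apply: RspanD => //.
by rewrite -opprB; apply/RspanN/cbasM.
Qed.

Lemma ccoef1 (t v : Std la) : ccoef C 1 t v = (t == v)%:R :> R.
Proof.
apply: (@ccoef_uniq 1 t t (fun v : Std la => (t == v)%:R)).
rewrite mulr1 (bigD1 t) //= eqxx scale1r big1 ?addr0 ?subrr; first exact: Rspan0.
by move=> w /negbTE; rewrite eq_sym => ->; rewrite scale0r.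
Qed.

Lemma ccoefD a b (t v : Std la) : ccoef C (a + b) t v = ccoef C a t v + ccoef C b t v.
Proof.
apply: (@ccoef_uniq _ t t (fun v => ccoef C a t v + ccoef C b t v)).
under eq_bigr do rewrite scalerDl.
by rewrite big_split mulrDr opprD addrACA; apply: RspanD; apply: cbasM.
Qed.

Lemma ccoefM a b (t w : Std la) :
  ccoef C (a * b) t w = \sum_v ccoef C a t v * ccoef C b v w.
Proof.
apply: (@ccoef_uniq _ t t (fun w => \sum_v ccoef C a t v * ccoef C b v w)).
have -> : \sum_w0 (\sum_v ccoef C a t v * ccoef C b v w0) *: cbas C t w0
        = \sum_v ccoef C a t v *: \sum_w0 ccoef C b v w0 *: cbas C t w0.
  under eq_bigr do rewrite scaler_suml.
  rewrite exchange_big; apply: eq_bigr => v _; rewrite scaler_sumr.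
  by apply: eq_bigr => w0 _; rewrite scalerA.
rewrite mulrA -[cbas C t t * a](subrK (\sum_v ccoef C a t v *: cbas C t v)).
rewrite mulrDl -addrA; apply: RspanD; first exact/span_aboveM/cbasM.
rewrite mulr_suml -sumrB; apply: Rspan_sum => v.
by rewrite -scalerAl -scalerBr; apply/RspanZ/cbasM.
Qed.

Local Notation cell_module := (cell_module C la).
HB.instance Definition _ := GRing.Zmodule.on cell_module.

Definition cell_scale (a : B^c) (f : cell_module) : cell_module :=
  [ffun v => \sum_t (f : {ffun _ -> _}) t * ccoef C a t v].

Fact cell_scaleA a b f : cell_scale a (cell_scale b f) = cell_scale (a * b) f.
Proof.
apply/ffunP => v; rewrite !ffunE.
under eq_bigr do rewrite ffunE mulr_suml.
rewrite exchange_big; apply: eq_bigr => t _.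
rewrite (_ : ccoef C (a * b) t v = ccoef C ((b : B) * (a : B)) t v) // ccoefM mulr_sumr.
by apply: eq_bigr => w _; rewrite mulrA.
Qed.
Fact cell_scale1 : left_id 1 cell_scale.
Proof.
move=> f; apply/ffunP => v; rewrite ffunE (bigD1 v) //= ccoef1 eqxx mulr1.
by rewrite big1 ?addr0 // => t /negbTE nt; rewrite ccoef1 nt mulr0.
Qed.
Fact cell_scaleDr : right_distributive cell_scale +%R.
Proof.
move=> a f g; apply/ffunP => v; rewrite !ffunE -big_split /=.
by apply: eq_bigr => t _; rewrite ffunE mulrDl.
Qed.
Fact cell_scaleDl f : {morph cell_scale^~ f : a b / a + b}.
Proof.
move=> a b; apply/ffunP => v; rewrite !ffunE -big_split /=.
by apply: eq_bigr => t _; rewrite ccoefD mulrDr.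
Qed.

HB.instance Definition _ := GRing.Zmodule_isLmodule.Build B^c cell_module
  cell_scaleA cell_scale1 cell_scaleDr cell_scaleDl.

End CellModule.
Section CellFiltration.
Variables (R : idomainType) (B : algType R).
Variables (disp : Order.disp_t) (hat : finPOrderType disp) (Std : hat -> finType).
Variable (C : cellular B Std).

Definition cyclic_cellular : Prop :=
  forall la, exists x : cell_module C la, forall y, exists a : B, y = ract x a.

(* An order preserving cell-filtration with factors Delta(lab 0), ..., Delta(lab (p-1)),
   listed from the bottom. *)
Definition cell_filtration (M : lmodType B^c) (p : nat) (lab : 'I_p -> hat) : Prop :=
  (forall i j : 'I_p, j = i.+1 :> nat -> (lab j < lab i)%O) /\
  exists F : nat -> submodClosed M,
    [/\ F 0%N =i pred1 0, F p =i predT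
      & forall i : 'I_p, exists pi : M -> cell_module C (lab i),
          subquotient_iso (@ract B M) (@ract B (cell_module C (lab i)))
            [set x | x \in F i.+1] [set x | x \in F i] pi].

Definition has_cell_filtration (M : lmodType B^c) : Prop :=
  exists p (lab : 'I_p -> hat), cell_filtration M lab.

End CellFiltration.

(* BF = B (x)_R F, with b (x) f represented by f *: j b. *)
Definition is_base_change (R : idomainType) (B : algType R)
    (BF : algType {fraction R}) (j : {rmorphism B -> BF}) : Prop :=
  is_tensor (fun (b : B) (r : R) => r *: b)
    (fun (r : R) (f : {fraction R}) => tofrac r * f) (fun b f => f *: j b).

Definition split_semisimple (F : fieldType) (B : algType F) : Prop :=
  exists n (d : 'I_n -> nat) (phi : forall i, {lrmorphism B -> 'M[F]_((d i).+1)}),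
    forall y : (forall i, 'M[F]_((d i).+1)), exists! x, forall i, phi i x = y i.

Definition generically_split_semisimple (R : idomainType) (B : algType R) : Prop :=
  exists (BF : algType {fraction R}) (j : {rmorphism B -> BF}),
    is_base_change j /\ split_semisimple BF.

Section Subalgebra.
Variables (R : comNzRingType) (U : algType R).

Definition subalg (S : subalgClosed U) : Type := {x : U | x \in S}.

Section Instances.
Variable S : subalgClosed U.
HB.instance Definition _ := SubChoice.on (subalg S).
HB.instance Definition _ := [SubChoice_isSubAlgebra of subalg S by <:].
End Instances.

Variables (S S' : subalgClosed U) (sSS' : {subset S <= S'}).

Definition subalg_incl (x : subalg S) : subalg S' :=
  Sub (val x) (sSS' (valP x)).

Fact subalg_incl_additive : zmod_morphism subalg_incl.
Proof. by move=> x y; apply: val_inj. Qed.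
Fact subalg_incl_multiplicative : monoid_morphism subalg_incl.
Proof. by split=> [|x y]; apply: val_inj. Qed.

HB.instance Definition _ :=
  GRing.isZmodMorphism.Build (subalg S) (subalg S') subalg_incl subalg_incl_additive.
HB.instance Definition _ :=
  GRing.isMonoidMorphism.Build (subalg S) (subalg S') subalg_incl
    subalg_incl_multiplicative.

End Subalgebra.

Record tower (R : idomainType) := Tower {
  tower_union :> algType R;
  level : nat -> subalgClosed tower_union;
  level_incr : forall k, {subset level k <= level k.+1};
  level_exhaust : forall x, exists k, x \in level k;
  level0 : forall x, x \in level 0%N <-> exists r : R, x = r%:A;
  level0_inj : injective (fun r : R => r%:A : tower_union) }.

Notation layer A k := (subalg (level A k)).

Record cellular_tower (R : idomainType) (A : tower R) := CellularTower {
  hat_disp : Order.disp_t;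
  hat : nat -> finPOrderType hat_disp;
  Std : forall k, hat k -> finType;
  cells : forall k, cellular (layer A k) (@Std k);
  tstar : A -> A;
  tstar_invol : alg_involution tstar;
  tstar_cells : forall k x, val (star (cells k) x) = tstar (val x) }.

Section Coherence.
Variables (R : idomainType) (A : tower R) (C : cellular_tower A).

Definition incl k : layer A k -> layer A k.+1 := subalg_incl (@level_incr R A k).
HB.instance Definition _ k := GRing.RMorphism.on (@incl k).

Definition Delta k (la : hat C k) : lmodType (layer A k)^c :=
  cell_module (cells C k) la.

Definition Res k (mu : hat C k.+1) : lmodType (layer A k)^c :=
  restrict (@incl k) (Delta mu).

Record strongly_coherent : Prop := {
  coh_cyclic : forall k, cyclic_cellular (cells C k);
  coh_ind : forall k (la : hat C k),
    exists (T : lmodType (layer A k.+1)^c) (tau : Delta la -> layer A k.+1 -> T),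
      is_induced (@incl k) tau /\ has_cell_filtration (cells C k.+1) T;
  coh_res : forall k (mu : hat C k.+1), has_cell_filtration (cells C k) (Res mu) }.

(* Under strong coherence and generic semisimplicity the labels occurring in a
   cell-filtration of the restriction do not depend on the filtration. *)
Definition branches k (la : hat C k) (mu : hat C k.+1) : Prop :=
  exists p (lab : 'I_p -> hat C k),
    cell_filtration (cells C k) (Res mu) lab /\ exists i, lab i = la.

End Coherence.

(* [e k] is the element e_k of A_{k+1}, k >= 1 ([e 0] is irrelevant). In dt_e,
   dt_quotient and dt_eAeA the index is shifted: they are usually stated for e_{k-1}
   in A_k, k >= 2. *)
Record diagram_tower (R : idomainType) (A H : tower R)
    (CA : cellular_tower A) (CH : cellular_tower H) (e : nat -> A) : Prop := {
  dt_level1 : exists phi : {lrmorphism layer A 1 -> layer H 1},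
    bijective phi /\ forall x, phi (star (cells CA 1) x) = star (cells CH 1) (phi x);
  dt_e : forall k, (0 < k)%N ->
    [/\ e k \in level A k.+1, tstar CA (e k) = e k
      & exists2 delta : R, delta != 0 & e k * e k = delta *: e k];
  dt_quotient : forall k, (0 < k)%N ->
    exists phi : {lrmorphism layer A k.+1 -> layer H k.+1},
      [/\ forall y, exists x, phi x = y,
          forall x, phi x = 0 <->
            Rspan [set z | exists a b, [/\ a \in level A k.+1, b \in level A k.+1
                                        & z = a * e k * b]] (val x)
        & forall x, phi (star (cells CA k.+1) x) = star (cells CH k.+1) (phi x)];
  dt_commute : forall k, (0 < k)%N -> forall x, x \in level A k.-1 -> e k * x = x * e k;
  dt_eAe : forall k, (0 < k)%N -> forall x, x \in level A k ->
    exists2 y, y \in level A k.-1 & e k * x * e k = y * e k;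
  dt_Ae : forall k, (0 < k)%N ->
    [set x * e k | x in [set x | x \in level A k.+1]] =
    [set x * e k | x in [set x | x \in level A k]];
  dt_Ae_inj : forall k, (0 < k)%N -> {in level A k &, injective (fun x => x * e k)};
  dt_ideal : forall k, (1 < k)%N ->
    Rspan [set z | exists a b, [/\ a \in level A k.+1, b \in level A k.+1
                                & z = a * e k * b]] (e k.-1);
  dt_coherent : strongly_coherent CH;
  dt_eAeA : forall k, (0 < k)%N ->
    Rspan [set z | exists a b, [/\ a \in level A k.+1, b \in level A k.+1
                                & z = e k * a * e k * b]] =
    [set e k * x | x in [set x | x \in level A k.+1]];
  dt_semisimple : forall k, generically_split_semisimple (layer A k) }.

Section JucysMurphy.
Variables (R : idomainType) (A : tower R) (C : cellular_tower A).

Definition acts_by_scalars k (a : A) : Prop :=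
  exists2 b : layer A k, val b = a &
    forall la : hat C k, exists d : R, forall x : Delta la, ract x b = ract x d%:A.

Definition jucys_murphy (L : nat -> A) : Prop :=
  (forall k, (0 < k)%N ->
     [/\ L k \in level A k, tstar C (L k) = L k
       & forall x, x \in level A k.-1 -> L k * x = x * L k]) /\
  ((forall k, acts_by_scalars k (\sum_(1 <= i < k.+1) L i)) \/
   ((forall k, (0 < k)%N -> exists2 y, y \in level A k & L k * y = 1 /\ y * L k = 1) /\
    (forall k, acts_by_scalars k (\prod_(1 <= i < k.+1) L i)))).

End JucysMurphy.

(* An injective unital algebra homomorphism from B (x)_R B' to E. *)
Record tensor_embedding (R : idomainType) (B B' E : algType R) := TensorEmbedding {
  te_tensor : algType R;
  te_left : {lrmorphism B -> te_tensor};
  te_right : {lrmorphism B' -> te_tensor};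
  te_comm : forall x y, te_left x * te_right y = te_right y * te_left x;
  te_univ : is_tensor (fun (x : B) (r : R) => r *: x) (fun (r : R) (y : B') => r *: y)
              (fun x y => te_left x * te_right y);
  te_map : {lrmorphism te_tensor -> E};
  te_inj : injective te_map }.

Record outer_products (R : idomainType) (A : tower R) := OuterProducts {
  outer : forall s r, (s <= r)%N ->
    tensor_embedding (layer A (r - s)) (layer A s) (layer A r);
  outer_incl : forall s r (le_sr : (s <= r)%N) (x : layer A (r - s)),
    val (te_map (outer le_sr) (te_left (outer le_sr) x)) = val x }.

(* The copy 1 x a in A_r of a in A_s. *)
Definition one_times (R : idomainType) (A : tower R) (P : outer_products A) s r
    (le_sr : (s <= r)%N) (a : layer A s) : A :=
  val (te_map (outer P le_sr) (te_right (outer P le_sr) a)).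

Section Paths.
Variables (R : idomainType) (A : tower R) (C : cellular_tower A).

Definition vertex : Type := {k : nat & hat C k}.
HB.instance Definition _ := Countable.on vertex.

Definition vtx k (la : hat C k) : vertex := Tagged (fun k => hat C k) la.

Definition vle (x y : vertex) : bool :=
  (tag x == tag y) && (tagged x <= tagged_as x y)%O.
Definition vlt (x y : vertex) : bool :=
  (tag x == tag y) && (tagged x < tagged_as x y)%O.

Definition edge : rel vertex := fun x y =>
  `[< exists k (la : hat C k) (mu : hat C k.+1),
        [/\ x = vtx la, y = vtx mu & branches la mu] >].

(* x :: p is a path in the branching graph that ends at y. *)
Definition is_path (x : vertex) (p : seq vertex) (y : vertex) : bool :=
  path edge x p && (last x p == y).

Record std_path r (nu : hat C r) := StdPath {
  vertices :> seq vertex;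
  _ : if vertices is x :: p then (tag x == 0%N) && is_path x p (vtx nu) else false }.

HB.instance Definition _ r (nu : hat C r) := [isSub for @vertices r nu].
HB.instance Definition _ r (nu : hat C r) := [Countable of std_path nu by <:].

Section Finiteness.

Fixpoint walks k n : seq (seq vertex) :=
  if n is n'.+1 then
    [seq vtx la :: p | la <- enum (hat C k), p <- walks k.+1 n']
  else [:: [::]].

Lemma path_walks x p : path edge x p ->
  p \in walks (tag x).+1 (size p) /\ tag (last x p) = (tag x + size p)%N.
Proof.
elim: p x => [|y p IH] x /=; first by rewrite addn0.
case/andP=> /asboolP [k [la [mu [-> -> _]]]] /IH [pw ->].
split; last by rewrite /= addSnnS.
by apply/allpairsP; exists (mu, p); rewrite mem_enum.
Qed.

Lemma std_path_walks r (nu : hat C r) (t : std_path nu) :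
  (vertices t) \in walks 0 r.+1.
Proof.
case: t => [[|x p] //= /andP [/eqP x0 /andP [/path_walks [pw E] /eqP lst]]].
move: E; rewrite lst x0 /= => E.
clear lst; case: x x0 pw E => k la /= k0; subst k => pw E.
apply/allpairsP; exists (la, p); split=> //; first by rewrite mem_enum.
by have -> : r = size p by rewrite E.
Qed.

Definition std_path_enc r (nu : hat C r) (t : std_path nu) : seq_sub (walks 0 r.+1) :=
  SeqSub (std_path_walks t).
Definition std_path_dec r (nu : hat C r) (p : seq_sub (walks 0 r.+1)) :
  option (std_path nu) := insub (val p).

Lemma std_path_encK r (nu : hat C r) :
  pcancel (@std_path_enc r nu) (@std_path_dec r nu).
Proof. by move=> t; rewrite /std_path_dec /= valK. Qed.

End Finiteness.

HB.instance Definition _ r (nu : hat C r) : isFinite (std_path nu) :=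
  PCanIsFinite (@std_path_encK r nu).

Definition dominates r (nu : hat C r) (s t : std_path nu) : bool :=
  all2 vle (vertices t) (vertices s).

Definition dominance_maximal r (nu : hat C r) (t : std_path nu) : Prop :=
  forall s : std_path nu, dominates s t -> s = t.

(* Products of edge labels along x :: p; the last edge is rightmost in [dprod]
   and leftmost in [uprod]. *)
Fixpoint dprod (d : vertex -> vertex -> A) x p : A :=
  if p is y :: q then d x y * dprod d y q else 1.
Fixpoint uprod (u : vertex -> vertex -> A) x p : A :=
  if p is y :: q then uprod u y q * u x y else 1.

Definition std_d d r (nu : hat C r) (t : std_path nu) : A :=
  if vertices t is x :: p then dprod d x p else 1.
Definition std_u u r (nu : hat C r) (t : std_path nu) : A :=
  if vertices t is x :: p then uprod u x p else 1.

Definition murphy_span (d u : vertex -> vertex -> A) r (P : pred (hat C r)) : set A :=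
  Rspan [set x | exists mu (p q : std_path mu), P mu /\ x = std_d d p * std_u u q].

Record murphy_basis := MurphyBasis {
  down_coef : vertex -> vertex -> A;
  up_coef : vertex -> vertex -> A;
  down_coef_in : forall x y, edge x y -> down_coef x y \in level A (tag y);
  up_coef_in : forall x y, edge x y -> up_coef x y \in level A (tag y);
  murphy : forall r, cellular (layer A r) (fun nu : hat C r => std_path nu : finType);
  murphy_star : forall r, star (murphy r) =1 star (cells C r);
  murphyE : forall r nu (s t : @std_path r nu),
    val (cbas (murphy r) s t) = std_d down_coef s * std_u up_coef t;
  up_coef_above : forall r nu (t : @std_path r nu),
    murphy_span down_coef up_coef [pred mu | (nu <= mu)%O] (std_u up_coef t);
  (* Delta(nu) is the right A_r-module with R-basis { u_t + A_r^{> nu} }. *)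
  murphy_Delta : forall r (nu : hat C r),
    let N := murphy_span down_coef up_coef [pred mu | (nu < mu)%O] in
    let P := [set x + y | x in Rspan (range (@std_u up_coef r nu)) & y in N] in
    (exists pi : A -> Delta nu,
       subquotient_iso (fun (x : A) (a : layer A r) => x * val a)
         (@ract _ (Delta nu)) P N pi) /\
    (forall f : {ffun std_path nu -> R},
       N (\sum_t f t *: std_u up_coef t) -> f = 0) }.

(* A_{s,r}^{> nu \ la}, for la on level r - s and nu on level r. *)
Definition skew_ideal (m : murphy_basis) s r (la : hat C (r - s)) (nu : hat C r) :
    set A :=
  Rspan ([set x | exists mu (p q : std_path mu),
            (nu < mu)%O /\ x = std_d (down_coef m) p * std_u (up_coef m) q] `|`
         [set x | exists t : std_path nu,
            vlt (vtx la) (nth (vtx la) (vertices t) (r - s)) /\ x = std_u (up_coef m) t]).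

(* The preimage in A_r of the R-module Delta_s(nu \ la) of A_r / A_{s,r}^{> nu \ la}. *)
Definition skew_span (m : murphy_basis) s r (la : hat C (r - s)) (nu : hat C r)
    (tla : std_path la) : set A :=
  [set x + y | x in Rspan [set x | exists2 p, is_path (vtx la) p (vtx nu)
                             & x = uprod (up_coef m) (vtx la) p * std_u (up_coef m) tla]
             & y in skew_ideal m la nu].

End Paths.

(* Main.v *)
Require Import Defs.
From HB Require Import structures.
From mathcomp Require Import all_boot all_order all_algebra.
From mathcomp Require Import boolp classical_sets.

Set Implicit Arguments.
Unset Strict Implicit.
Unset Printing Implicit Defensive.

Import Order.TTheory GRing.Theory.
Local Open Scope ring_scope.

(** Put k = r - s.  The copy of A_s in A_r commutes with A_k, hence it preserves
whatever the action of A_k singles out in the cell module Delta(nu) of A_r, that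
is, in the span of the u_t modulo A_r^{> nu}.  The proof singles out in this way
the two submodules at hand: the span of the u_t with t(k) > la, and its sum with
the span of the u_t for the paths t that begin with t^la.  Everything is done over
R, with nonzero scalars in place of the denominators that idempotents would need.

The first submodule.  Let S be an upper set of labels on level k and J_S the ideal
of A_k spanned by the cellular basis elements with label in S.  As A_k is
generically split semisimple, it is von Neumann regular up to nonzero scalars
([regular_up_to_scalar]); hence J_S contains an element w with j w = g j for all j
in J_S, where g is a nonzero scalar ([cideal_right_unit]).  If t(k) is in S, then
u_t is a left multiple of the u-element of the first k steps of t, which is in J_S;
so u_t w = g u_t.  Conversely these u_t generate the whole g-eigenspace of w up to
torsion, by a count of ranks ([cell_eigen_rank]): w kills the cell modules of A_k
with label outside S, and iterated restriction filters Delta(nu) by cell modules of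
A_k, one for each path from level k to nu at most, because the labels of an order
preserving filtration are distinct.  As a span of basis vectors is pure, it equals
the eigenspace ([ideal_right_unit]), and the eigenspace is stable under everything
that commutes with w.

The second submodule.  Regularity also yields q in A_k that maps every u_{t'},
t' a path to la, into R u_{t^la} modulo A_k^{> la}, and multiplies u_{t^la} by a
nonzero scalar c ([cell_projector]).  Let t begin with t^la and let b be in the copy
of A_s.  By the first part for the labels >= la, the element u_t b is a combination
of u_v with v(k) >= la, and q takes all of these into the second submodule.  But
q commutes with b, so u_t b q is c u_t b up to the first submodule; purity allows
the division by c ([skew_commute]).  The module sought is then the quotient of
the second submodule by the first ([subquotient_exists]). *)

(** * Ranks over an integral domain *)

Section Rank.
Variable R : idomainType.
Local Notation F := {fraction R}.

Lemma fracP (x : F) : exists n d : R, d != 0 /\ tofrac d * x = tofrac n.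
Proof.
rewrite -[x]reprK; move: (repr x) => {}x.
exists x.1, x.2; split; first exact: denom_ratioP.
unlock tofrac; rewrite -[LHS]FracField.pi_mul.
apply/eqmodP; rewrite /= FracField.equivfE /FracField.mulf /=.
rewrite !numden_Ratio ?oner_neq0 ?mul1r ?mulr1 //.
all: exact: denom_ratioP.
Qed.

Lemma common_denominator (I : finType) (f : I -> F) :
  exists (c : R) (h : I -> R), c != 0 /\ forall i, tofrac c * f i = tofrac (h i).
Proof.
have /choice [h hP] : forall i, exists h : R * R,
    h.2 != 0 /\ tofrac h.2 * f i = tofrac h.1.
  by move=> i; have [n [d H]] := fracP (f i); exists (n, d).
exists (\prod_i (h i).2), (fun i => (\prod_(j | j != i) (h j).2) * (h i).1); split.
  by apply/prodf_neq0 => i _; case: (hP i).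
move=> i; have [_ E] := hP i.
by rewrite (bigD1 i) //= mulrC rmorphM mulrA [f i * _]mulrC E -rmorphM mulrC.
Qed.

Lemma tofracmx_inj m n : injective (@map_mx _ _ (@tofrac R) m n).
Proof.
move=> A B /matrixP E; apply/matrixP => i j; apply/eqP.
by rewrite -tofrac_eq; have := E i j; rewrite !mxE => ->.
Qed.

Section Def.
Variable V : lmodType R.

Definition independent (J : finType) (v : J -> V) : Prop :=
  forall a : J -> R, \sum_j a j *: v j = 0 -> forall j, a j = 0.

(** The rank is bounded through independent families, so that no submodule of R^n
needs to be free. *)
Definition rank_le (M : set V) (n : nat) : Prop :=
  forall (J : finType) (v : J -> V), (forall j, M (v j)) -> independent v -> (#|J| <= n)%N.

End Def.

(** Relations among rows over the field of fractions become relations over R once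
multiplied by a common denominator. *)
Lemma fracmx_free p n (B : 'M[R]_(p, n)) :
  (forall a : 'rV[R]_p, a *m B = 0 -> a = 0) <-> row_free (map_mx (@tofrac R) B).
Proof.
split=> [H|/row_freeP [C E] a aB].
  rewrite -kermx_eq0; apply/rowV0P => v /sub_kermxP vB.
  have [c [h [c0 hE]]] := common_denominator (fun j => v 0 j).
  have : \row_j h j = 0.
    apply: H; apply: tofracmx_inj.
    rewrite map_mxM map_mx0 (_ : map_mx _ _ = tofrac c *: v) -?scalemxAl ?vB ?scaler0 //.
    by apply/rowP => j; rewrite !mxE.
  move=> h0; apply/rowP => j; rewrite mxE; apply/eqP.
  have /eqP := hE j; move/rowP/(_ j): h0; rewrite !mxE => ->.
  by rewrite tofrac0 mulf_eq0 tofrac_eq0 (negPf c0).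
apply: tofracmx_inj.
by rewrite -[LHS]mulmx1 -E mulmxA -map_mxM aB !map_mx0 mul0mx.
Qed.

(** Subadditivity of the rank.  Of an independent family in M, the images under pi
have some rank over the field of fractions, which M'' bounds; the relations among
these images, cleared of denominators, form an independent family in M'. *)
Lemma rank_ext (V : lmodType R) (I : finType) (M M' : set V)
    (M'' : set {ffun I -> R^o}) (pi : V -> {ffun I -> R^o}) m n :
  M 0 -> (forall r x y, M x -> M y -> M (r *: x + y)) ->
  (forall r x y, M x -> M y -> pi (r *: x + y) = r *: pi x + pi y) ->
  (forall x, M x -> M'' (pi x)) -> (forall x, M x -> pi x = 0 -> M' x) ->
  rank_le M' m -> rank_le M'' n -> rank_le M (m + n).
Proof.
move=> M0 MZD piZD piM'' kerM' M'm M''n J v Mv indv.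
have pi0 : pi 0 = 0.
  by have := piZD (-1) 0 0 M0 M0; rewrite scaler0 addr0 scaleN1r addNr.
have Msum (K : finType) (a : K -> R) (u : K -> V) : (forall k, M (u k)) ->
    M (\sum_k a k *: u k) /\ pi (\sum_k a k *: u k) = \sum_k a k *: pi (u k).
  move=> Mu; elim/big_rec2: _ => [//|k x y _ [My <-]].
  by split; [apply: MZD | rewrite piZD].
pose w (i : 'I_#|J|) := v (enum_val i).
pose B := \matrix_(i < #|J|, j < #|I|) (pi (w i) (enum_val j) : R).
have mulB q (a : 'I_q -> R) (f : 'I_q -> 'I_#|J|) j :
    (\sum_i a i *: pi (w (f i))) (enum_val j) = (\row_i a i *m rowsub f B) 0 j.
  rewrite sum_ffunE mxE; apply: eq_bigr => i _.
  by rewrite !mxE ffunE.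
have eqB q (a : 'I_q -> R) (f : 'I_q -> 'I_#|J|) :
    \sum_i a i *: pi (w (f i)) = 0 <-> \row_i a i *m rowsub f B = 0.
  split=> E; first by apply/rowP => j; rewrite -mulB E ffunE mxE.
  by apply/ffunP => x; rewrite -(enum_rankK x) mulB E mxE ffunE.
pose BF := map_mx (@tofrac R) B.
have le_n : (\rank BF <= n)%N.
  rewrite -[X in (X <= _)%N]card_ord.
  (* a maximal independent subfamily of the images *)
  apply: (M''n _ (fun i => pi (w (maxrankfun BF i)))) => [i|a /eqB E i].
    exact/piM''/Mv.
  have /fracmx_free H : row_free (map_mx (@tofrac R) (rowsub (maxrankfun BF) B)).
    by rewrite map_mxsub; apply: maxrowsub_free.
  by have /rowP/(_ i) := H _ E; rewrite !mxE.
have le_m : (\rank (kermx BF) <= m)%N.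
  (* the rows of Kr are a basis of the relations among the pi (w i), made integral *)
  pose K := row_base (kermx BF).
  have [c [h [c0 hE]]] := common_denominator (fun ij => K ij.1 ij.2).
  pose Kr := \matrix_(i, j) h (i, j).
  have KrE : map_mx (@tofrac R) Kr = tofrac c *: K.
    by apply/matrixP => i j; rewrite 2![in LHS]mxE [RHS]mxE; have /= <- := hE (i, j).
  have KB : Kr *m B = 0.
    apply: tofracmx_inj.
    rewrite map_mxM map_mx0 KrE -scalemxAl (_ : K *m _ = 0) ?scaler0 //.
    by apply/sub_kermxP; rewrite eq_row_base.
  rewrite -[X in (X <= _)%N]card_ord.
  pose z i := \sum_j Kr i j *: w j.
  apply: (M'm _ z) => [i|a aE i].
    have [Mz piz] := Msum _ (fun j => Kr i j) w (fun j => Mv _).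
    apply: kerM' => //; rewrite piz.
    apply/(eqB _ _ id); rewrite mxsub_id.
    have -> : \row_j Kr i j = row i Kr by apply/rowP => j; rewrite [LHS]mxE [RHS]mxE.
    by rewrite -row_mul KB; apply/rowP => j; rewrite !mxE.
  have aK : \row_i a i *m Kr = 0.
    apply/rowP => j; rewrite !mxE.
    pose b x := (\row_i a i *m Kr) 0 (enum_rank x).
    have := indv b; rewrite (_ : \sum_ _ _ = 0).
      move=> /(_ erefl (enum_val j)); rewrite /b enum_valK mxE; exact.
    rewrite -{}[RHS]aE /z.
    under [RHS]eq_bigr do rewrite scaler_sumr.
    rewrite exchange_big (reindex _ (onW_bij _ (enum_val_bij J))) /=; apply: eq_bigr => k _.
    rewrite /b enum_valK mxE scaler_suml; apply: eq_bigr => l _.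
    by rewrite mxE scalerA.
  have /fracmx_free H : row_free (map_mx (@tofrac R) Kr).
    rewrite KrE /row_free mxrank_scale_nz ?tofrac_eq0 //.
    exact: row_base_free.
  by have /rowP/(_ i) := H _ aK; rewrite !mxE.
rewrite mxrank_ker in le_m.
by rewrite -(subnK (rank_leq_row BF)); apply: leq_add.
Qed.

Lemma rank_zero (V : lmodType R) (M : set V) n : (forall x, M x -> x = 0) -> rank_le M n.
Proof.
move=> M0 J v Mv indv; case: (pickP J) => [j _|/eq_card0 -> //].
have := indv (fun => 1); rewrite big1 => [/(_ erefl j)/eqP|i _].
  by rewrite oner_eq0.
by rewrite (M0 _ (Mv i)) scaler0.
Qed.

Lemma rank_sub (V : lmodType R) (M M' : set V) m n :
  (forall x, M x -> M' x) -> (m <= n)%N -> rank_le M' m -> rank_le M n.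
Proof.
move=> sMM' le_mn H J v Mv indv; apply: leq_trans le_mn.
by apply: H indv => j; apply/sMM'/Mv.
Qed.

Lemma rank_ffun (I : finType) (M : set {ffun I -> R^o}) : rank_le M #|I|.
Proof.
move=> J v _ indv.
pose B := \matrix_(i < #|J|, j < #|I|) (v (enum_val i) (enum_val j) : R).
have /fracmx_free/eqP : forall a : 'rV_#|J|, a *m B = 0 -> a = 0; last first.
  by move=> <-; apply: rank_leq_col.
move=> a aB; apply/rowP => i; rewrite mxE -(enum_valK i).
apply: (indv (fun j => a 0 (enum_rank j))).
apply/ffunP => x; rewrite sum_ffunE ffunE -(enum_rankK x).
move/rowP/(_ (enum_rank x)): aB; rewrite !mxE => {2}<-.
rewrite (reindex _ (onW_bij _ (enum_val_bij J))) /=; apply: eq_bigr => k _.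
by rewrite !ffunE enum_valK !mxE.
Qed.

End Rank.

(** * Quotients of submodules *)

Section Subzmodule.
Variables (U : zmodType) (S : zmodClosed U).
Definition subzmod : Type := {x : U | x \in S}.
HB.instance Definition _ := SubChoice.on subzmod.
HB.instance Definition _ := [SubChoice_isSubZmodule of subzmod by <:].
End Subzmodule.

Lemma quotient_zmodule (V : zmodType) (N : {pred V}) : zmod_closed N ->
  exists (Q : zmodType) (q : V -> Q),
    [/\ {morph q : x y / x + y}, forall y, exists x, q x = y
      & forall x, (q x = 0) <-> (x \in N)].
Proof.
move=> cN; pose zN : zmodClosed V := HB.pack N (GRing.isZmodClosed.Build V N cN).
exists (Quotient.quot zN), (\pi_(Quotient.quot zN))%qT; split.
- exact: raddfD.
- by move=> y; exists (repr y); rewrite reprK.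
move=> x; rewrite -[x in x \in N]subr0.
by rewrite (Quotient.idealrBE zN) -(raddf0 (\pi_(Quotient.quot zN))%qT); split=> /eqP.
Qed.

Lemma submodule_zmodule (U : zmodType) (S : {pred U}) : zmod_closed S ->
  exists (D : zmodType) (i : D -> U),
    [/\ {morph i : x y / x + y}, injective i & forall y, y \in S <-> exists x, i x = y].
Proof.
move=> cS; pose zS : zmodClosed U := HB.pack S (GRing.isZmodClosed.Build U S cS).
exists (subzmod zS), val; split=> [//||y]; first exact: val_inj.
split=> [Sy|[x <-]]; last exact: valP.
by exists (Sub y Sy); rewrite SubK.
Qed.

Section ScaledZmodule.
Variables (K : pzRingType) (D : zmodType) (sc : K -> D -> D).
Hypotheses (scA : forall a b v, sc a (sc b v) = sc (a * b) v) (sc1 : left_id 1 sc).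
Hypotheses (scDr : right_distributive sc +%R).
Hypotheses (scDl : forall v, {morph sc^~ v : a b / a + b}).

(** The hypotheses on the scaling occur in the body so that the type determines the
module structure built from them. *)
Definition scaled_zmodule : Type := let _ := (scA, sc1, scDr, scDl) in D.
HB.instance Definition _ := GRing.Zmodule.on scaled_zmodule.
HB.instance Definition _ :=
  GRing.Zmodule_isLmodule.Build K scaled_zmodule scA sc1 scDr scDl.
End ScaledZmodule.

(** The quotient is realized as the group of classes modulo N that meet P; scalars act on
representatives chosen in P. *)
Lemma subquotient_exists (V : zmodType) (B : nzRingType) (act : V -> B -> V)
    (P N : set V) :
  (forall x, N x -> P x) ->
  N 0 -> (forall x y, N x -> N y -> N (x - y)) ->
  (forall x y, P x -> P y -> P (x - y)) ->
  (forall x a, N x -> N (act x a)) -> (forall x a, P x -> P (act x a)) ->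
  (forall a, {morph act^~ a : x y / x + y}) ->
  (forall x, {morph act x : a b / a + b}) ->
  (forall x, act x 1 = x) -> (forall x a b, act x (a * b) = act (act x a) b) ->
  exists (D : lmodType B^c) (pi : V -> D), subquotient_iso act (@ract B D) P N pi.
Proof.
move=> sNP N0 NB PB Nact Pact actDl actDr act1 actM.
have PD x y : P x -> P y -> P (x + y).
  move=> Px Py; rewrite -[y]opprK; apply: (PB) => //.
  by rewrite -sub0r; apply: (PB) => //; apply: sNP.
have cN : zmod_closed (fun x => `[< N x >]).
  by split=> [|x y /asboolP Nx /asboolP Ny]; apply/asboolP => //; apply: NB.
have [Q [q [qD qS qK]]] := quotient_zmodule cN.
have q0 : q 0 = 0 by apply/qK/asboolP.
have qN x : q (- x) = - q x by apply/eqP; rewrite -addr_eq0 -qD addNr q0.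
have qE x y : q x = q y <-> N (x - y).
  split=> [E|/asboolP/qK]; last by rewrite qD qN => /eqP; rewrite subr_eq0 => /eqP.
  by apply/asboolP/qK; rewrite qD qN E subrr.
have cP : zmod_closed (fun y => `[< exists2 x, P x & q x = y >]).
  split=> [|x y /asboolP [x' Px <-] /asboolP [y' Py <-]]; apply/asboolP.
    by exists 0 => //; apply: sNP.
  by exists (x' - y'); rewrite ?qD ?qN //; apply: PB.
have [D [i [iD iI iS]]] := submodule_zmodule cP.
have /choice [r rP] : forall d, exists x, P x /\ q x = i d.
  move=> d; have /iS/asboolP [x Px E] : exists x, i x = i d by exists d.
  by exists x.
have Pr d : P (r d) by case: (rP d).
have qr d : q (r d) = i d by case: (rP d).
have /choice [p pP] : forall x, exists d, P x -> i d = q x.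
  move=> x; case: (pselect (P x)) => [Px|]; last by exists 0.
  by have /iS [d] : q x \in (fun y => `[< exists2 x, P x & q x = y >]);
    [apply/asboolP; exists x | exists d].
have pE x y : P x -> P y -> N (x - y) -> p x = p y.
  by move=> Px Py /qE E; apply: iI; rewrite !pP.
have pD x y : P x -> P y -> p (x + y) = p x + p y.
  by move=> Px Py; apply: iI; rewrite iD !pP ?qD //; apply: PD.
have pr d : p (r d) = d by apply: iI; rewrite pP.
have Nrp x : P x -> N (r (p x) - x) by move=> Px; apply/qE; rewrite qr pP.
have actB a x y : act (x - y) a = act x a - act y a.
  by apply/eqP; rewrite eq_sym subr_eq -actDl subrK.
pose sc (a : B^c) (d : D) : D := p (act (r d) (a : B)).
have scE a x : P x -> sc a (p x) = p (act x a).
  by move=> Px; apply: pE; [exact: Pact|exact: Pact|rewrite -actB; apply/Nact/Nrp].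
have scA a b v : sc a (sc b v) = sc (a * b) v.
  have -> : sc b v = p (act (r v) b) by [].
  by rewrite scE -?actM //; apply: Pact.
have sc1 : left_id 1 sc by move=> d; rewrite /sc act1.
have scDr : right_distributive sc +%R.
  move=> a u v; rewrite -[u]pr -[v]pr -pD // !scE // ?actDl ?pD //; try exact: Pact.
  exact: PD.
have scDl v : {morph sc^~ v : a b / a + b}.
  by move=> a b; rewrite /sc actDr pD //; apply: Pact.
pose L : lmodType B^c := @scaled_zmodule B^c D sc scA sc1 scDr scDl.
exists L, p; split=> //.
- by move=> x a Px; rewrite /ract -scE.
- by move=> d; exists (r d).
have i0 : i 0 = 0 by apply: (addrI (i 0)); rewrite -iD !addr0.
move=> x Px; split=> [px|/asboolP/qK qx]; last by apply: iI; rewrite pP // i0.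
by apply/asboolP/qK; rewrite -pP // px.
Qed.

(** * Generic semisimplicity without idempotents *)

Section Coordinates.
Variables (R : pzRingType) (V : lmodType R) (I : finType) (b : I -> V).
Hypothesis basis_b : is_basis b.

Definition coord (x : V) : {ffun I -> R} := projT1 (cid (basis_b x)).

Lemma coordE x : x = \sum_i coord x i *: b i.
Proof. by rewrite /coord; case: (cid _) => f [/= <-]. Qed.

Lemma coord_uniq x (f : I -> R) : x = \sum_i f i *: b i -> coord x =1 f.
Proof.
move=> xE i; rewrite /coord; case: (cid _) => g [/= _ /(_ (finfun f))].
rewrite xE => -> ; first by rewrite ffunE.
by apply: eq_bigr => j _; rewrite ffunE.
Qed.

Lemma coordZD r x y i : coord (r *: x + y) i = r * coord x i + coord y i.
Proof.
apply: (coord_uniq (f := fun i => r * coord x i + coord y i)).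
rewrite {1}[x]coordE {1}[y]coordE scaler_sumr -big_split.
by apply: eq_bigr => j _; rewrite scalerA scalerDl.
Qed.

Lemma coordD x y i : coord (x + y) i = coord x i + coord y i.
Proof. by have := coordZD 1 x y i; rewrite scale1r mul1r. Qed.

Lemma coord0 i : coord 0 i = 0.
Proof. by apply: (addrI (coord 0 i)); rewrite -coordD !addr0. Qed.

Lemma coordZ r x i : coord (r *: x) i = r * coord x i.
Proof. by rewrite -[_ *: _]addr0 coordZD coord0 addr0. Qed.

Lemma coord_sum (K : finType) (f : K -> V) i :
  coord (\sum_k f k) i = \sum_k coord (f k) i.
Proof. exact: (big_morph _ (fun x y => coordD x y i) (coord0 i)). Qed.

Lemma coord_basis i j : coord (b i) j = (i == j)%:R.
Proof.
apply: (coord_uniq (f := fun j => (i == j)%:R)).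
rewrite (bigD1 i) //= eqxx scale1r big1 ?addr0 // => k /negbTE.
by rewrite eq_sym => ->; rewrite scale0r.
Qed.

End Coordinates.

Section Regular.
Variables (R : idomainType) (B : algType R) (I : finType) (b : I -> B).
Hypothesis basis_b : is_basis b.

(** A product of matrix algebras over a field is von Neumann regular, since each
matrix M satisfies M X M = M for some X; clearing denominators in the base change
leaves the scalar c. *)
Lemma regular_up_to_scalar : generically_split_semisimple B ->
  forall y, exists (y' : B) (c : R), c != 0 /\ y * y' * y = c *: y.
Proof.
move=> [BF [j [[bal univ] [n [d [phi phiP]]]]]] y.
have [_ jR jZ] := bal.
have jS r x : j (r *: x) = tofrac r *: j x.
  by have := jZ x r 1; rewrite scale1r mulr1.
pose co x := [ffun i => tofrac (coord basis_b x i)] : {ffun I -> {fraction R}^o}.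
have [|g [gE _]] := univ {ffun I -> {fraction R}^o} (fun x f => f *: co x).
  split=> [f x z|x f f'|x r f].
  - by apply/ffunP => i; rewrite !ffunE coordD tofracD -scalerDr.
  - by rewrite -scalerDl.
  - by apply/ffunP => i; rewrite !ffunE coordZ tofracM scalerA mulrC.
(* the universal property provides coordinates on BF, so that j is injective *)
have jI x : j x = 0 -> x = 0.
  move=> jx; rewrite [x](coordE basis_b) big1 // => i _.
  have := gE x 1; rewrite jx scaler0 raddf0 scale1r => /ffunP/(_ i).
  rewrite !ffunE => /esym/eqP; rewrite tofrac_eq0 => /eqP ->.
  by rewrite scale0r.
(* and the j (b i) span BF: the identity and the projection to their span agree on
   the tensors *)
have spanBF z : exists f : I -> {fraction R}, z = \sum_i f i *: j (b i).
  pose h z := \sum_i g z i *: j (b i).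
  have hD : zmod_morphism h.
    move=> u v; rewrite /h -sumrB; apply: eq_bigr => i _.
    by rewrite raddfB !ffunE scalerBl.
  pose hA : {additive BF -> BF} := HB.pack h (GRing.isZmodMorphism.Build BF BF h hD).
  have [k [kE kU]] := univ BF _ bal.
  exists (g z); have idE := kU idfun (fun _ _ => erefl) z.
  rewrite -[LHS]/(idfun z) idE; apply/esym/(kU hA) => x f; rewrite /= /h gE.
  rewrite {2}[x](coordE basis_b) raddf_sum scaler_sumr.
  by apply: eq_bigr => i _; rewrite !ffunE /= jS scalerA.
have fracBF z : exists x c, c != 0 /\ tofrac c *: z = j x.
  have [f ->] := spanBF z.
  have [c [h [c0 hE]]] := common_denominator f.
  exists (\sum_i h i *: b i), c; split=> //.
  rewrite [RHS]raddf_sum scaler_sumr; apply: eq_bigr => i _.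
  by rewrite /= jS scalerA hE.
have [x [xE _]] := phiP (fun i => pinvmx (phi i (j y))).
have regBF : j y * x * j y = j y.
  have [z [_ zU]] := phiP (fun i => phi i (j y)).
  transitivity z; last exact: zU.
  apply/esym/zU => i; rewrite !rmorphM.
  have regM (M X : 'M[{fraction R}]_((d i).+1)) : X = pinvmx M -> M * X * M = M.
    by move=> ->; apply: mulmxKpV.
  exact/regM/xE.
have [y' [c [c0 xy']]] := fracBF x.
exists y', c; split=> //; apply/eqP; rewrite -subr_eq0; apply/eqP/jI.
by rewrite rmorphB !rmorphM jS -xy' -scalerAr -scalerAl regBF subrr.
Qed.

End Regular.

(** * Ideals of a cellular algebra spanned by upper sets of labels *)

Section CellularIdeals.
Variables (R : idomainType) (B : algType R).
Variables (disp : Order.disp_t) (hat : finPOrderType disp) (Std : hat -> finType).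
Variable C : cellular B Std.

Local Notation cell_index := {la : hat & (Std la * Std la)%type}.
Local Notation cindex s t := (Tagged (fun la => (Std la * Std la)%type) (s, t)).
Local Notation ccoord := (coord (cbas_basis C)).

Definition upset (S : pred hat) : Prop :=
  forall la mu, S la -> (la <= mu)%O -> S mu.

Definition cideal (S : pred hat) : set B :=
  Rspan [set x | exists mu (p q : Std mu), S mu /\ x = cbas C p q].

Lemma ccoord_cbas la (s t : Std la) i : ccoord (cbas C s t) i = (cindex s t == i)%:R.
Proof. exact: (coord_basis (cbas_basis C) (cindex s t) i). Qed.

Lemma cideal_coord (S : pred hat) x i : cideal S x -> ~~ S (tag i) -> ccoord x i = 0.
Proof.
move=> + nS; move: x; apply: (Rspan_ind (P := [set x | ccoord x i = 0])).
  exact: coord0.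
move=> r _ y [mu [p [q [Smu ->]]]] /= y0; rewrite coordZD y0 addr0 ccoord_cbas.
by case: eqP => [E|]; rewrite ?mulr0 //; rewrite -E Smu in nS.
Qed.

Lemma cbas_mulr la (s t : Std la) a :
  exists2 z, span_above (cbas C) la z
    & cbas C s t * a = \sum_v ccoef C a t v *: cbas C s v + z.
Proof.
exists (cbas C s t * a - \sum_v ccoef C a t v *: cbas C s v); first exact: cbasM.
by rewrite addrC subrK.
Qed.

Lemma cideal_mulr S x a : upset S -> cideal S x -> cideal S (x * a).
Proof.
move=> upS; apply: (Rspan_ind (P := [set x | cideal S (x * a)])) => /=.
  by rewrite mul0r; apply: Rspan0.
move=> r _ y [mu [p [q [Smu ->]]]] IH; rewrite mulrDl -scalerAl; apply: RspanZD => //.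
have [z zJ ->] := cbas_mulr p q a; apply: RspanD.
  by apply: Rspan_sum => v; apply/RspanZ/Rspan_mem; exists mu, p, v.
apply: Rspan_ind zJ; first exact: Rspan0.
move=> k _ t [nu [p' [q' [lt_nu ->]]]] Jt; apply: RspanZD => //.
by apply: Rspan_mem; exists nu, p', q'; split=> //; apply: upS (ltW lt_nu).
Qed.

Lemma starZD r x y : star C (r *: x + y) = r *: star C x + star C y.
Proof. by case: (star_invol C). Qed.

Lemma starM x y : star C (x * y) = star C y * star C x.
Proof. by case: (star_invol C). Qed.

Lemma starK : involutive (star C).
Proof. by case: (star_invol C). Qed.

Lemma star0 : star C 0 = 0.
Proof. by have := starZD (-1) 0 0; rewrite scaler0 addr0 scaleN1r addNr. Qed.

Lemma cideal_star S x : cideal S x -> cideal S (star C x).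
Proof.
apply: (Rspan_ind (P := [set x | cideal S (star C x)])) => /=.
  by rewrite star0; apply: Rspan0.
move=> r _ y [mu [p [q [Smu ->]]]] /= IH; rewrite starZD star_cbas; apply: RspanZD => //.
by apply: Rspan_mem; exists mu, q, p.
Qed.

Lemma cideal_mull S a x : upset S -> cideal S x -> cideal S (a * x).
Proof.
move=> upS Jx; rewrite -[a * x]starK starM.
exact/cideal_star/cideal_mulr/cideal_star.
Qed.

Lemma upset_above la : upset [pred mu | (la < mu)%O].
Proof. by move=> mu nu /= lt_la le_mu; apply: lt_le_trans le_mu. Qed.

Lemma ccoord_mulr la (s t v : Std la) a :
  ccoord (cbas C s t * a) (cindex s v) = ccoef C a t v.
Proof.
have [z zJ ->] := cbas_mulr s t a.
rewrite coordD (@cideal_coord [pred mu | (la < mu)%O] z) ?addr0 /= ?ltxx //.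
rewrite coord_sum (bigD1 v) //= coordZ ccoord_cbas eqxx mulr1 big1 ?addr0 // => w nw.
by rewrite coordZ ccoord_cbas eq_Tagged /= xpair_eqE (negPf nw) andbF mulr0.
Qed.

(** The involution turns the rule for right multiplication into one for left
multiplication, which fixes the second index modulo higher labels. *)
Lemma ccoord_mull la (s t s' t' : Std la) a : t' != t ->
  ccoord (a * cbas C s t) (cindex s' t') = 0.
Proof.
move=> ne_t; rewrite -[a * _]starK starM star_cbas.
have [z zJ ->] := cbas_mulr t s (star C a).
have -> : star C (\sum_v ccoef C (star C a) s v *: cbas C t v + z)
        = \sum_v ccoef C (star C a) s v *: cbas C v t + star C z.
  elim/big_rec2: _ => [|v x y _ IH]; first by rewrite !add0r.
  by rewrite -!addrA starZD star_cbas IH.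
rewrite coordD (@cideal_coord [pred mu | (la < mu)%O] (star C z)) /= ?ltxx //; last first.
  exact: cideal_star.
rewrite addr0 coord_sum big1 // => w _.
rewrite coordZ ccoord_cbas eq_Tagged /= xpair_eqE [t == t']eq_sym (negPf ne_t).
by rewrite andbF mulr0.
Qed.

(** An ideal of labels in S annihilates the cell modules with label outside S. *)
Lemma ccoef_cideal S la (t v : Std la) w :
  upset S -> cideal S w -> ~~ S la -> ccoef C w t v = 0.
Proof.
move=> upS Jw nS; rewrite -(ccoord_mulr t).
by apply: (cideal_coord (S := S)) => //; apply: cideal_mull.
Qed.

Hypothesis regC : forall y : B, exists (y' : B) (c : R), c != 0 /\ y * y' * y = c *: y.

(** The unit is built one basis element x at a time.  If w is a right unit up to g for
the previous ones, regularity gives f in the ideal with y f = c y for the defect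
y = g x - x w, and then (g - w)(c - f) kills both x and the previous elements from
the right. *)
Lemma cideal_right_unit S : upset S -> exists (w : B) (g : R),
  [/\ g != 0, cideal S w & forall x, cideal S x -> x * w = g *: x].
Proof.
move=> upS.
suff unit_on (s : seq cell_index) : exists (w : B) (g : R), [/\ g != 0, cideal S w &
    forall i : cell_index, i \in s -> S (tag i) ->
      cbas C (tagged i).1 (tagged i).2 * w = g *: cbas C (tagged i).1 (tagged i).2].
  have [w [g [g0 Jw wE]]] := unit_on (enum {: cell_index}).
  exists w, g; split=> // x.
  apply: (Rspan_ind (P := [set x | x * w = g *: x])) => /=.
    by rewrite mul0r scaler0.
  move=> r _ y [mu [p [q [Smu ->]]]] IH; rewrite mulrDl scalerDr -scalerAl IH.
  by rewrite (wE (cindex p q)) ?mem_enum // !scalerA mulrC.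
elim: s => [|i s [w [g [g0 Jw wE]]]].
  by exists 0, 1; split; rewrite ?oner_eq0 //; apply: Rspan0.
case: (boolP (S (tag i))) => [Si|nSi]; last first.
  exists w, g; split=> // j; rewrite inE => /orP [/eqP ->|]; last exact: wE.
  by rewrite (negPf nSi).
pose x := cbas C (tagged i).1 (tagged i).2.
have Jx : cideal S x by apply: Rspan_mem; exists (tag i), (tagged i).1, (tagged i).2.
pose y := g *: x - x * w.
have [y' [c [c0 yE]]] := regC y.
have Jy : cideal S y.
  by apply: RspanZD => //; apply/RspanN/cideal_mull.
pose f := y' * y; have yf : y * f = c *: y by rewrite mulrA.
exists (c *: w + (g *: f - w * f)), (g * c); split; first exact: mulf_neq0.
  apply: RspanZD => //; apply: RspanZD; first exact: cideal_mull.
  by apply/RspanN/cideal_mull => //; apply: cideal_mull.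
have E (z : B) : z * (c *: w + (g *: f - w * f)) = c *: (z * w) + (g *: z - z * w) * f.
  by rewrite mulrDr mulrBr mulrBl -!scalerAr -scalerAl (mulrA z w f).
move=> j; rewrite inE => /orP [/eqP -> _|js Sj].
  by rewrite E -/x -/y yf /y scalerBr addrC subrK scalerA [c * g]mulrC.
by rewrite E wE // subrr mul0r addr0 scalerA mulrC.
Qed.

(** With c y = y y' y for y = c_{t0 t0}, take q = y' y: modulo higher labels, left
multiples of c_{t0 t0} involve only second index t0, while y q = c y. *)
Lemma cell_projector la (t0 : Std la) : exists q : B,
  ccoef C q t0 t0 != 0 /\ forall t v, v != t0 -> ccoef C q t v = 0.
Proof.
have [y' [c [c0 yE]]] := regC (cbas C t0 t0).
exists (y' * cbas C t0 t0); split=> [|t v ne_v].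
  by rewrite -(ccoord_mulr t0) mulrA yE coordZ ccoord_cbas eqxx mulr1.
by rewrite -(ccoord_mulr t) mulrA ccoord_mull.
Qed.

End CellularIdeals.

(** * Cutting and extending paths *)

Section PathSplitting.
Variables (R : idomainType) (A : tower R) (C : cellular_tower A).
Implicit Types x y : vertex C.

Lemma level_le j k : (j <= k)%N -> {subset level A j <= level A k}.
Proof.
move=> /subnKC <-; elim: (k - j)%N => [|n IH] x; first by rewrite addn0.
by rewrite addnS => /IH /level_incr.
Qed.

Lemma vtx_inj k : injective (@vtx R A C k).
Proof. by move=> la mu /eqP; rewrite eq_Tagged => /eqP. Qed.

Lemma std_pathP r (nu : hat C r) (t : std_path nu) : exists x p,
  [/\ vertices t = x :: p, tag x = 0%N, path (@edge _ _ C) x p & last x p = vtx nu].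
Proof.
by case: t => [[|x p] //= /andP [/eqP x0 /andP [xp /eqP lst]]]; exists x, p.
Qed.

Lemma size_std_path r (nu : hat C r) (t : std_path nu) : size (vertices t) = r.+1.
Proof.
have [x [p [-> x0 /path_walks [_] /[swap] ->]]] := std_pathP t.
by rewrite x0 /= => ->.
Qed.

Lemma nth_std_path r (nu : hat C r) (t : std_path nu) x : nth x (vertices t) r = vtx nu.
Proof.
have [y [p [E _ _ <-]]] := std_pathP t; have := size_std_path t.
by rewrite E /= => -[<-]; rewrite nth_last.
Qed.

Lemma std_path_cat k r (mu : hat C k) (nu : hat C r) (t : std_path mu) p :
  is_path (vtx mu) p (vtx nu) -> exists t' : std_path nu, vertices t' = vertices t ++ p.
Proof.
move=> /andP [ep lp]; have [x [q [E x0 eq lq]]] := std_pathP t.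
have H : (if vertices t ++ p is x :: p' then (tag x == 0%N) && is_path x p' (vtx nu)
    else false) = true.
  by rewrite E /= x0 eqxx /is_path cat_path last_cat lq eq ep.
by exists (StdPath H).
Qed.

Lemma std_path_split k r (nu : hat C r) (t : std_path nu) : (k <= r)%N ->
  exists (mu : hat C k) (t' : std_path mu) p,
    is_path (vtx mu) p (vtx nu) /\ vertices t = vertices t' ++ p.
Proof.
move=> le_kr; have [x [q [E x0 eq lq]]] := std_pathP t.
have := size_std_path t; rewrite E /= => -[sq].
move: eq lq; rewrite -{1 2}(cat_take_drop k q) cat_path last_cat => /andP [e1 e2] lq.
have [_] := path_walks e1; rewrite x0 size_takel ?sq //.
case El : (last x (take k q)) => [k' mu] /= Ek; rewrite add0n in Ek; subst k'.
have H : (if x :: take k q is x :: p' then (tag x == 0%N) && is_path x p' (vtx mu)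
    else false) = true.
  by rewrite /= x0 /is_path e1 El; apply: eqxx.
exists mu, (@StdPath _ _ _ _ mu (x :: take k q) H), (drop k q).
split; last by rewrite /= cat_take_drop.
by rewrite /is_path -lq El; move: e2; rewrite El => ->; apply: eqxx.
Qed.

Lemma nth_cat_std_path k r (mu : hat C k) (nu : hat C r) (t : std_path mu)
    (t' : std_path nu) p x :
  vertices t' = vertices t ++ p -> nth x (vertices t') k = vtx mu.
Proof. by move=> ->; rewrite nth_cat size_std_path ltnSn nth_std_path. Qed.

Lemma uprod_cat (u : vertex C -> vertex C -> A) x p q :
  uprod u x (p ++ q) = uprod u (last x p) q * uprod u x p.
Proof. by elim: p x => [|y p IH] x /=; rewrite ?mulr1 // IH mulrA. Qed.

Lemma std_u_cat (u : vertex C -> vertex C -> A) k r (mu : hat C k) (nu : hat C r)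
    (t : std_path mu) (t' : std_path nu) p :
  vertices t' = vertices t ++ p -> std_u u t' = uprod u (vtx mu) p * std_u u t.
Proof.
rewrite /std_u => ->; have [x [q [-> _ _ lq]]] := std_pathP t.
by rewrite /= uprod_cat lq.
Qed.

Lemma dprod_level (d : vertex C -> vertex C -> A) x p :
  (forall x y, edge x y -> d x y \in level A (tag y)) ->
  path (@edge _ _ C) x p -> dprod d x p \in level A (tag (last x p)).
Proof.
move=> dP; elim: p x => [|y p IH] x /=; first by rewrite rpred1.
case/andP=> exy eyp; apply: rpredM; last exact: IH.
have [_ ->] := path_walks eyp.
by apply: (level_le (leq_addr _ _)); apply: dP.
Qed.

End PathSplitting.

(** * The Murphy basis and the cell modules *)

Lemma ract_scalar (R : idomainType) (B : algType R) (disp : Order.disp_t)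
    (hat : finPOrderType disp) (Std : hat -> finType) (C : cellular B Std) (la : hat)
    (f : cell_module C la) (r : R) :
  ract f r%:A = r *: (f : {ffun Std la -> R^o}) :> {ffun Std la -> R^o}.
Proof.
have coefE (t v : Std la) : ccoef C r%:A t v = r * (t == v)%:R.
  move: v; apply: (ccoef_uniq (s := t)).
  rewrite -scalerAr mulr1 (bigD1 t) //= eqxx mulr1 big1 ?addr0 ?subrr; first exact: Rspan0.
  by move=> w /negbTE; rewrite eq_sym => ->; rewrite mulr0 scale0r.
apply/ffunP => v; rewrite !ffunE (bigD1 v) //= coefE eqxx mulr1 big1 ?addr0 1?mulrC //.
by move=> t /negbTE nt; rewrite coefE nt !mulr0.
Qed.

Section MurphyBasis.
Variables (R : idomainType) (A : tower R) (C : cellular_tower A) (m : murphy_basis C).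
Local Notation d := (down_coef m).
Local Notation u := (up_coef m).

Lemma std_d_level r (nu : hat C r) (t : std_path nu) : std_d d t \in level A r.
Proof.
rewrite /std_d; have [x [p [-> _ xp lp]]] := std_pathP t.
by have := dprod_level (@down_coef_in _ _ _ m) xp; rewrite lp.
Qed.

Lemma murphy_spanE r (S : pred (hat C r)) x :
  murphy_span d u S x <-> exists2 y : layer A r, cideal (murphy m r) S y & val y = x.
Proof.
split=> [|[y Sy <-]].
  move: x; apply: (Rspan_ind (P := [set x | exists2 y : layer A r,
    cideal (murphy m r) S y & val y = x])).
    by exists 0; [apply: Rspan0 | exact: raddf0].
  move=> a _ y [mu [p [q [Smu ->]]]] [z Jz <-].
  exists (a *: cbas (murphy m r) p q + z); last by rewrite /= murphyE.
  by apply: RspanZD => //; apply: Rspan_mem; exists mu, p, q.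
move: y Sy; apply: (Rspan_ind (P := [set y : layer A r | murphy_span d u S (val y)])).
  exact: (@Rspan0 R A).
move=> a _ y [mu [p [q [Smu ->]]]] /= IH; apply: RspanZD => //.
by apply: Rspan_mem; exists mu, p, q; rewrite -murphyE.
Qed.

Lemma murphy_span_mulr r (S : pred (hat C r)) x a : upset S -> a \in level A r ->
  murphy_span d u S x -> murphy_span d u S (x * a).
Proof.
move=> upS La /murphy_spanE [y Sy <-]; apply/murphy_spanE.
by exists (y * (Sub a La : layer A r)); first exact: cideal_mulr.
Qed.

Lemma murphy_span_mull r (S : pred (hat C r)) x a : upset S -> a \in level A r ->
  murphy_span d u S x -> murphy_span d u S (a * x).
Proof.
move=> upS La /murphy_spanE [y Sy <-]; apply/murphy_spanE.
by exists ((Sub a La : layer A r) * y); first exact: cideal_mull.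
Qed.

Lemma murphy_span_sub r (S S' : pred (hat C r)) x : (forall mu, S mu -> S' mu) ->
  murphy_span d u S x -> murphy_span d u S' x.
Proof.
move=> SS' [n [a [v [vS ->]]]]; exists n, a, v; split=> // i.
by have [mu [p [q [/SS' Smu E]]]] := vS i; exists mu, p, q.
Qed.

Section Cell.
Variables (r : nat) (nu : hat C r).
Local Notation N := (murphy_span d u [pred mu | (nu < mu)%O]).
Local Notation P :=
  ([set x + y | x in Rspan (range (@std_u _ _ C u r nu)) & y in N])%classic.
Local Notation M := (cell_module (murphy m r) nu).

(** Rows of coordinates f stand for elements of the cell module of nu, whose class is
that of this combination. *)
Definition std_u_sum (f : std_path nu -> R) : A := \sum_t f t *: std_u u t.

Lemma std_u_sumZD a (f g : std_path nu -> R) :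
  std_u_sum (fun t => a * f t + g t) = a *: std_u_sum f + std_u_sum g.
Proof.
rewrite /std_u_sum scaler_sumr -big_split; apply: eq_bigr => t _.
by rewrite scalerDl scalerA.
Qed.

Lemma eq_std_u_sum (f g : std_path nu -> R) : f =1 g -> std_u_sum f = std_u_sum g.
Proof. by move=> E; apply: eq_bigr => t _; rewrite E. Qed.

Lemma std_u_sumZB a (f g : std_path nu -> R) :
  std_u_sum (fun t => a * f t - g t) = a *: std_u_sum f - std_u_sum g.
Proof.
rewrite /std_u_sum scaler_sumr -sumrB; apply: eq_bigr => t _.
by rewrite scalerBl scalerA.
Qed.

Lemma std_u_sum_delta t : std_u_sum (fun t' => (t' == t)%:R) = std_u u t.
Proof.
rewrite /std_u_sum (bigD1 t) //= eqxx scale1r big1 ?addr0 // => t' /negbTE ->.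
by rewrite scale0r.
Qed.

Lemma cell_preimageP x : P x <-> exists f : {ffun std_path nu -> R}, N (x - std_u_sum f).
Proof.
split=> [[y Sy [z Nz <-]]|[f Nf]]; last first.
  exists (std_u_sum f); last by exists (x - std_u_sum f); rewrite // addrC subrK.
  by apply: Rspan_sum => t; apply/RspanZ/Rspan_mem; exists t.
have [f ->] : exists f : {ffun std_path nu -> R}, y = std_u_sum f.
  move: y Sy; apply: (Rspan_ind (P := [set y |
    exists f : {ffun std_path nu -> R}, y = std_u_sum f])).
    by exists [ffun=> 0]; rewrite /std_u_sum big1 // => t _; rewrite ffunE scale0r.
  move=> a _ y [t _ <-] [f ->].
  exists [ffun t' => a * (t' == t)%:R + f t'].
  transitivity (std_u_sum (fun t' => a * (t' == t)%:R + f t')).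
    by rewrite std_u_sumZD std_u_sum_delta.
  by apply: eq_bigr => t' _; rewrite ffunE.
by exists f; rewrite addrC addKr.
Qed.

Lemma std_u_sum_inj (f : {ffun std_path nu -> R}) : N (std_u_sum f) -> f = 0.
Proof. by have [_] := murphy_Delta m nu; apply. Qed.

Lemma murphy_above_mulr x (a : layer A r) : N x -> N (x * val a).
Proof. by apply: murphy_span_mulr; [apply: upset_above | apply: valP]. Qed.

(** The u_t transform as the rows of the Murphy basis do.  Some coefficients exist as
the span of the u_t modulo N is stable; multiplying by d_t on the left recovers the
defining congruence of the cellular basis and thus identifies them. *)
Lemma std_u_act t (a : layer A r) :
  N (std_u u t * val a - std_u_sum (ccoef (murphy m r) a t)).
Proof.
have [[pi piP] _] := murphy_Delta m nu.
have : P (std_u u t * val a).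
  apply: (sq_stable piP); apply/cell_preimageP.
  exists [ffun t' => (t' == t)%:R]; rewrite -std_u_sum_delta /std_u_sum.
  by rewrite -sumrB big1 => [|t' _]; [apply: Rspan0 | rewrite ffunE subrr].
move=> /cell_preimageP [g Ng].
suff E : ccoef (murphy m r) a t =1 g.
  by rewrite (_ : std_u_sum _ = std_u_sum g) //; apply: eq_bigr => v _; rewrite E.
apply: (@ccoef_uniq _ _ _ _ _ (murphy m r) nu a t t).
have /murphy_spanE [y Jy yE] := murphy_span_mull (@upset_above _ _ nu) (std_d_level t) Ng.
rewrite (_ : _ - _ = y) //; apply: val_inj; rewrite yE mulrBr mulrA /std_u_sum mulr_sumr.
rewrite raddfB raddf_sum /= murphyE; congr (_ - _); apply: eq_bigr => v _.
by rewrite murphyE scalerAr.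
Qed.

Lemma std_u_sum_act (f : M) (a : layer A r) :
  N (std_u_sum f * val a - std_u_sum (ract f a)).
Proof.
have -> : std_u_sum f * val a - std_u_sum (ract f a)
    = \sum_t f t *: (std_u u t * val a - std_u_sum (ccoef (murphy m r) a t)).
  rewrite /std_u_sum mulr_suml.
  under [RHS]eq_bigr do rewrite scalerBr scaler_sumr.
  rewrite sumrB; congr (_ - _); first by apply: eq_bigr => t _; rewrite scalerAl.
  rewrite exchange_big; apply: eq_bigr => v _; rewrite ffunE scaler_suml.
  by apply: eq_bigr => t _; rewrite scalerA.
by apply: Rspan_sum => t; apply/RspanZ/std_u_act.
Qed.

Lemma cell_preimage_std_u_sum (f : std_path nu -> R) : P (std_u_sum f).
Proof.
exists (std_u_sum f); last by exists 0; rewrite ?addr0 //; apply: Rspan0.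
by apply: Rspan_sum => t; apply/RspanZ/Rspan_mem; exists t.
Qed.

(** The filtrations of restrictions speak of the given cellular structure, whose basis
may differ from the Murphy basis; this isomorphism carries results across. *)
Lemma murphy_cell_iso :
  exists phi : {ffun std_path nu -> R^o} -> {ffun Std nu -> R^o},
  [/\ forall a f g, phi (a *: f + g) = a *: phi f + phi g,
      forall f, phi f = 0 -> f = 0,
      forall y, exists f, phi f = y
    & forall (f : M) (a : layer A r), phi (ract f a) = ract (phi f : Delta nu) a].
Proof.
have [[pi piP] _] := murphy_Delta m nu.
have NP x : N x -> P x by apply: (sq_sub piP).
have piN x y : P x -> N (y - x) -> pi x = pi y.
  move=> Px Nyx; have /(sq_ker piP) [_ /(_ Nyx) E] := NP _ Nyx.
  by rewrite -[y](subrK x) (sq_add piP) ?E ?add0r //; apply: NP.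
have piZ a x : P x -> pi (a *: x) = a *: (pi x : {ffun Std nu -> R^o}).
  move=> Px; rewrite -(ract_scalar (pi x)) -(sq_act piP) //; congr (pi _).
  by rewrite /= -scalerAr mulr1.
exists (fun f => pi (std_u_sum f)); split.
- move=> a f g; rewrite -piZ; last exact: cell_preimage_std_u_sum.
  rewrite -(sq_add piP); [|rewrite -[a *: _]addr0|exact: cell_preimage_std_u_sum].
    by rewrite -std_u_sumZD; congr (pi _); apply: eq_bigr => t _; rewrite !ffunE.
  have := cell_preimage_std_u_sum (fun t => a * f t + 0).
  rewrite std_u_sumZD; congr P; congr (_ + _).
  by rewrite /std_u_sum big1 // => t _; rewrite scale0r.
- by move=> f /(sq_ker piP) H; apply/std_u_sum_inj/H/cell_preimage_std_u_sum.
- move=> y; have [x /cell_preimageP [f Nf] <-] := sq_onto piP y.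
  by exists f; apply: piN => //; apply: cell_preimage_std_u_sum.
move=> f a; rewrite -(sq_act piP); last exact: cell_preimage_std_u_sum.
by apply: piN; [apply: cell_preimage_std_u_sum | apply: std_u_sum_act].
Qed.

End Cell.
End MurphyBasis.

(** * The rank of an eigenspace *)

Section EigenspaceRank.
Variables (R : idomainType) (A : tower R) (C : cellular_tower A) (m : murphy_basis C).
Hypothesis coherent : strongly_coherent C.
Variables (k : nat) (T : pred (vertex C)) (x0 : vertex C).

(** The vertex x0 is only a default for nth: a path to level r >= k has a vertex on
level k. *)
Definition passes r (nu : hat C r) : pred (std_path nu) :=
  [pred t | T (nth x0 (vertices t) k)].
Arguments passes [r] nu.

Lemma chain_inj (disp : Order.disp_t) (T' : porderType disp) p (lab : 'I_p -> T') :
  (forall i j : 'I_p, j = i.+1 :> nat -> (lab j < lab i)%O) -> injective lab.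
Proof.
move=> dec; have lt_lab (i j : 'I_p) : (i < j)%N -> (lab j < lab i)%O.
  case: j => j jp /= ; elim: j jp => // j IH jp; rewrite ltnS leq_eqVlt => /orP [/eqP E|ij].
    by apply: dec; rewrite /= -E.
  by apply: lt_trans (IH (ltnW jp) ij); apply: dec.
move=> i j E; apply/val_inj; case: (ltngtP i j) => // /lt_lab.
  by rewrite E ltxx.
by rewrite E ltxx.
Qed.

(** A path to a label of the filtration extends by one edge to a path to nu.  This is
injective because the labels, being strictly decreasing, are distinct. *)
Lemma card_passes_step r (nu : hat C r.+1) p (lab : 'I_p -> hat C r) :
  (k <= r)%N -> cell_filtration (cells C r) (Res nu) lab ->
  (\sum_i #|passes (lab i)| <= #|passes nu|)%N.
Proof.
move=> le_kr filt; have edge_lab i : edge (vtx (lab i)) (vtx nu).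
  by apply/asboolP; exists r, (lab i), nu; split=> //; exists p, lab; split=> //; exists i.
have ext i (t : std_path (lab i)) : exists t' : std_path nu, vertices t' = rcons t (vtx nu).
  case: (@std_path_cat _ _ _ _ _ _ nu t [:: vtx nu]) => [|t' E].
    by rewrite /is_path /= edge_lab eqxx.
  by exists t'; rewrite E cats1.
pose I := {i : 'I_p & std_path (lab i)}.
have /choice [h hP] : forall s : I, exists t' : std_path nu,
    vertices t' = rcons (tagged s) (vtx nu) by move=> s; apply: ext.
have h_inj : injective h.
  move=> [i t] [j t'] E; have := hP (Tagged _ t); rewrite E hP /= => /rcons_inj [Ett'].
  have Eij : i = j.
    apply: (chain_inj (proj1 filt)); apply: vtx_inj.
    by rewrite -(nth_std_path t x0) -(nth_std_path t' x0) Ett'.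
  by subst j; congr existT; apply: val_inj.
under eq_bigr do rewrite -sum1_card.
rewrite sig_big_dep /= sum1_card -(card_image h_inj).
apply: subset_leq_card; apply/fintype.subsetP => y /mapP [[i t]].
rewrite mem_enum !inE => Tt ->; move: Tt.
by rewrite /= hP nth_rcons size_std_path ltnS le_kr.
Qed.

Variables (w : A) (g : R).
Hypothesis level_w : w \in level A k.
Hypothesis g_neq0 : g != 0.
Hypothesis w_kills : forall mu : hat C k, ~~ T (vtx mu) ->
  forall f : Delta mu, ract f (Sub w level_w : layer A k) = 0.

Definition cell_eigen r (a : layer A r) (nu : hat C r) : set {ffun Std nu -> R^o} :=
  fun f => (ract (f : Delta nu) a : {ffun Std nu -> R^o}) = g *: f.

Arguments cell_eigen [r] a nu.

Lemma rank_Delta r (nu : hat C r) (M : set {ffun Std nu -> R^o}) :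
  rank_le M #|{: std_path nu}|.
Proof.
have [phi [phiZD _ phi_onto _]] := murphy_cell_iso m nu.
have phi0 : phi 0 = 0.
  by have := phiZD (-1) 0 0; rewrite scaler0 addr0 scaleN1r addNr.
move=> J v _ indv; have /choice [f fE] := fun j => phi_onto (v j).
apply: (@rank_ffun R (std_path nu : finType) (fun => True) J f) => // a aE.
apply: indv; transitivity (phi (\sum_j a j *: f j)); last by rewrite aE.
by elim/big_rec2: _ => [//|j x y _ ->]; rewrite phiZD fE.
Qed.

(** Induction on r.  On level k, either a kills the cell module, so that nothing but 0
is scaled by g, or all paths to nu count.  Above level k, the eigenspace meets the
steps of the cell-filtration of the restriction in subquotients that embed in
eigenspaces of cell modules one level below. *)
Lemma cell_eigen_rank r (nu : hat C r) (a : layer A r) : (k <= r)%N -> val a = w ->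
  rank_le (cell_eigen a nu) #|passes nu|.
Proof.
have base r' (nu' : hat C r') (b : layer A r') : k = r' -> val b = w ->
    rank_le (cell_eigen b nu') #|passes nu'|.
  move=> E; case: r' / E nu' b => nu' b bw; case: (boolP (T (vtx nu'))) => [Tnu|nTnu].
    apply: (rank_sub _ _ (@rank_Delta k nu' (fun=> True))) => //.
    by apply: subset_leq_card; apply/fintype.subsetP => t _; rewrite inE /= nth_std_path.
  apply: rank_zero => f; rewrite /cell_eigen.
  have -> : b = Sub w level_w by apply: val_inj.
  rewrite w_kills // => /ffunP f0; apply/ffunP => t.
  move: (f0 t); rewrite !ffunE => /esym/eqP.
  by rewrite mulf_eq0 (negPf g_neq0) => /eqP.
elim: r nu a => [|r IH] nu a; rewrite leq_eqVlt => /orP [/eqP E|//].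
  exact: base.
  exact: base.
rewrite ltnS => le_kr aw.
have [p [lab [dec [F [F0 Fp filt]]]]] := coh_res coherent nu.
have La : w \in level A r by apply: (level_le le_kr).
pose b : layer A r := Sub w La.
have ab : incl b = a by apply: val_inj; rewrite aw.
have rank_b i : rank_le (cell_eigen b (lab i)) #|passes (lab i)| by apply: IH.
have actR (x : Res nu) c : ract x c = ract (x : Delta nu) (incl c) by [].
have scR (x : Res nu) c :
    ract x c%:A = c *: (x : {ffun Std nu -> R^o}) :> {ffun Std nu -> R^o}.
  rewrite actR; have -> : incl (c%:A : layer A r) = c%:A by apply: val_inj.
  exact: ract_scalar.
have FZD i c (x y : {ffun Std nu -> R^o}) : (x : Res nu) \in F i -> (y : Res nu) \in F i ->
    (c *: x + y : Res nu) \in F i.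
  move=> xF yF; rewrite -(scR (x : Res nu)).
  exact: (rpredD (rpredZ (c%:A : (layer A r)^c) xF) yF).
have eZD c x y : cell_eigen a nu x -> cell_eigen a nu y -> cell_eigen a nu (c *: x + y).
  rewrite /cell_eigen => Ex Ey; rewrite scalerDr scalerA mulrC -scalerA -Ex -Ey.
  apply/ffunP => t; rewrite !ffunE /= scaler_sumr -big_split; apply: eq_bigr => t' _.
  by rewrite !ffunE /= mulrDl -mulrA.
pose FE i : set {ffun Std nu -> R^o} :=
  fun f => (f : Res nu) \in F i /\ cell_eigen a nu f.
suff chain i : (i <= p)%N -> rank_le (FE i)
      (\sum_(j < p | (j < i)%N) #|passes (lab j)|).
  apply: (rank_sub _ _ (chain p (leqnn p))) => [f fe|].
    by split=> //; have -> := Fp f.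
  under eq_bigl do rewrite ltn_ord.
  by apply: (card_passes_step le_kr); split=> //; exists F.
elim: i => [_|i IHi lt_ip].
  by apply: rank_zero => f [fF _]; apply/eqP; rewrite -[_ == _](F0 f).
pose io := Ordinal lt_ip.
have [pi piP] := filt io.
rewrite (bigD1 io) //= addnC.
have -> : (\sum_(j < p | (j < i.+1)%N && (j != io)) #|passes (lab j)|
    = \sum_(j < p | (j < i)%N) #|passes (lab j)|)%N.
  by apply: eq_bigl => j; rewrite -val_eqE /= ltnS [RHS]ltn_neqAle andbC.
have piZ c (x : {ffun Std nu -> R^o}) : (x : Res nu) \in F i.+1 ->
    pi (c *: x) = c *: (pi x : {ffun Std (lab io) -> R^o}) :> {ffun Std (lab io) -> R^o}.
  by move=> xF; rewrite -(scR (x : Res nu)) (sq_act piP) // ract_scalar.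
apply: (@rank_ext R {ffun Std nu -> R^o} (Std (lab io)) (FE i.+1) (FE i)
  (cell_eigen b (lab io)) pi _ _ _ _ _ _ _ (IHi (ltnW lt_ip)) (rank_b io)).
- split; first exact: rpred0.
  apply/ffunP => t; rewrite !ffunE scaler0 big1 // => t' _.
  by rewrite ffunE mul0r.
- by move=> c x y [xF xe] [yF ye]; split; [apply: FZD | apply: eZD].
- move=> c x y [xF _] [yF _]; rewrite -piZ //; apply: (sq_add piP) => //.
  rewrite -[c *: x]addr0; apply: FZD => //; exact: rpred0.
- move=> x [xF xe]; rewrite /cell_eigen -piZ // -xe -(sq_act piP) // actR.
  by rewrite -/b ab.
by move=> x [xF xe] /(sq_ker piP xF).
Qed.

End EigenspaceRank.
Arguments cell_eigen {R A C} g {r} a nu _.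

(** * Spans of Murphy basis vectors inside the cell module *)

Section SpanOn.
Variables (R : idomainType) (A : tower R) (C : cellular_tower A) (m : murphy_basis C).
Variables (r : nat) (nu : hat C r).
Local Notation d := (down_coef m).
Local Notation u := (up_coef m).
Local Notation N := (murphy_span d u [pred mu | (nu < mu)%O]).
Local Notation usum := (std_u_sum m).
Implicit Types Q : pred (std_path nu).

(** The preimage in A_r of the span of part of the basis of the cell module; it contains
A_r^{> nu}. *)
Definition span_on Q : set A := [set x | exists f : {ffun std_path nu -> R},
  (forall t, ~~ Q t -> f t = 0) /\ N (x - usum f)].

Lemma span_onZD Q a x y : span_on Q x -> span_on Q y -> span_on Q (a *: x + y).
Proof.
move=> [f [f0 Nf]] [h [h0 Nh]]; exists [ffun t => a * f t + h t]; split.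
  by move=> t nQ; rewrite ffunE f0 // h0 // mulr0 addr0.
rewrite (eq_std_u_sum m (g := fun t => a * f t + h t)); last by move=> t; rewrite ffunE.
rewrite std_u_sumZD.
by rewrite opprD addrACA -scalerBr; apply: RspanZD.
Qed.

Lemma span_on_N Q x : N x -> span_on Q x.
Proof.
move=> Nx; exists 0; split=> [t _|]; first by rewrite ffunE.
by rewrite /std_u_sum big1 ?subr0 // => t _; rewrite ffunE scale0r.
Qed.

Lemma span_on0 Q : span_on Q 0.
Proof. by apply/span_on_N/Rspan0. Qed.

Lemma span_onZ Q a x : span_on Q x -> span_on Q (a *: x).
Proof. by move=> Qx; rewrite -[_ *: _]addr0; apply: span_onZD => //; apply: span_on0. Qed.

Lemma span_onD Q x y : span_on Q x -> span_on Q y -> span_on Q (x + y).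
Proof. by move=> Qx Qy; rewrite -[x]scale1r; apply: span_onZD. Qed.

Lemma span_onB Q x y : span_on Q x -> span_on Q y -> span_on Q (x - y).
Proof. by move=> Qx Qy; rewrite addrC -scaleN1r; apply: span_onZD. Qed.

Lemma span_on_std_u Q t : Q t -> span_on Q (std_u u t).
Proof.
move=> Qt; exists [ffun t' => (t' == t)%:R]; split.
  by move=> t'; rewrite ffunE; case: eqP => // ->; rewrite Qt.
rewrite -std_u_sum_delta (eq_std_u_sum m (g := fun t' => (t' == t)%:R)).
  by rewrite subrr; apply: Rspan0.
by move=> t'; rewrite ffunE.
Qed.

Lemma span_on_sub Q Q' x : (forall t, Q t -> Q' t) -> span_on Q x -> span_on Q' x.
Proof.
move=> QQ' [f [f0 Nf]]; exists f; split=> // t nQ'.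
by apply: f0; apply: contra nQ'; apply: QQ'.
Qed.

Lemma span_on_mulr Q Q' a x : a \in level A r ->
  (forall t, Q t -> span_on Q' (std_u u t * a)) -> span_on Q x -> span_on Q' (x * a).
Proof.
move=> La QQ' [f [f0 Nf]]; rewrite -[x](subrK (usum f)) mulrDl.
apply: span_onD.
  by apply: span_on_N; apply: (murphy_above_mulr (Sub a La : layer A r)).
rewrite /std_u_sum mulr_suml; elim/big_ind: _; [exact: span_on0|exact: span_onD|].
move=> t _; rewrite -scalerAl; case: (boolP (Q t)) => [/QQ'|/f0 ->]; first exact: span_onZ.
by rewrite scale0r; apply: span_on0.
Qed.

Lemma span_onT_mulr a x : a \in level A r -> span_on predT x -> span_on predT (x * a).
Proof.
move=> La; apply: span_on_mulr => // t _.
exists (finfun (ccoef (murphy m r) (Sub a La : layer A r) t)); split=> //.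
rewrite (eq_std_u_sum m (g := ccoef (murphy m r) (Sub a La : layer A r) t)).
  exact: (@std_u_act _ _ _ m _ _ t (Sub a La : layer A r)).
by move=> v; rewrite ffunE.
Qed.

(** The quotient by the span of part of a basis is torsion-free. *)
Lemma span_on_pure Q c x : c != 0 -> span_on predT x -> span_on Q (c *: x) -> span_on Q x.
Proof.
move=> c0 [f [_ Nf]] [h [h0 Nh]]; exists f; split=> // t nQ.
have : N (usum [ffun t => c * f t - h t]).
  rewrite (eq_std_u_sum m (g := fun t => c * f t - h t)); last by move=> t'; rewrite ffunE.
  rewrite std_u_sumZB -[c *: usum f](addKr (c *: (x - usum f))) {2}scalerBr subrK -addrA.
  by apply: RspanD => //; apply/RspanN/RspanZ.
move=> /std_u_sum_inj/ffunP/(_ t); rewrite !ffunE h0 // subr0 => /eqP.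
by rewrite mulf_eq0 (negPf c0) => /eqP.
Qed.

End SpanOn.

(** * Eigenspaces are spans of basis vectors *)

Section RestrictionFiltration.
Variables (R : idomainType) (A : tower R) (C : cellular_tower A) (m : murphy_basis C).
Hypothesis coherent : strongly_coherent C.
Hypothesis regular : forall k (y : layer A k),
  exists (y' : layer A k) (c : R), c != 0 /\ y * y' * y = c *: y.
Variables (k r : nat) (nu : hat C r).
Hypothesis le_kr : (k <= r)%N.
Local Notation d := (down_coef m).
Local Notation u := (up_coef m).
Local Notation N := (murphy_span d u [pred mu | (nu < mu)%O]).
Local Notation usum := (std_u_sum m).
Local Notation ideal T := (murphy_span d u [pred mu : hat C k | T (vtx mu)]).
Local Notation through x0 T := (span_on m (passes k T x0 (nu := nu))).

Local Notation cellspan := (span_on m (nu := nu) predT).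

Lemma ract_eigen (f : {ffun std_path nu -> R}) (a : layer A r) g :
  N (usum f * val a - g *: usum f) ->
  (ract (f : cell_module (murphy m r) nu) a : {ffun std_path nu -> R^o})
    = g *: (f : {ffun std_path nu -> R^o}).
Proof.
move=> Nf; pose h : {ffun std_path nu -> R^o} := ract (f : cell_module (murphy m r) nu) a.
rewrite -[LHS]/h.
have : N (usum [ffun t => g * f t - h t]).
  rewrite (eq_std_u_sum m (g := fun t => g * f t - h t)); last by move=> t; rewrite ffunE.
  rewrite std_u_sumZB -(subrKA (usum f * val a)); apply: RspanD.
    by rewrite -opprB; apply: RspanN.
  exact: std_u_sum_act.
move=> /std_u_sum_inj/ffunP f0; apply/ffunP => t; move: (f0 t); rewrite !ffunE.
by move=> /eqP; rewrite subr_eq0 => /eqP.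
Qed.

(** The first k steps of t contribute the right factor of u_t, which lies in the ideal
of every upper set that contains t(k). *)
Lemma std_u_factor (T : pred (vertex C)) x0 (t : std_path nu) :
  upset [pred mu : hat C k | T (vtx mu)] -> passes k T x0 t ->
  exists z j, ideal T j /\ std_u u t = z * j.
Proof.
move=> upT; have [mu [t' [p [pP E]]]] := std_path_split t le_kr.
rewrite /passes /= (nth_cat_std_path x0 E) => Tmu.
exists (uprod u (vtx mu) p), (std_u u t'); split; last exact: std_u_cat.
apply: murphy_span_sub (up_coef_above m t') => mu' /= le_mu.
exact: upT Tmu le_mu.
Qed.

(** The eigenspace of w for g is spanned by the basis vectors with t(k) in the upper
set: were some f in it nonzero at another path t0, then f together with these
basis vectors would be an independent family exceeding the rank. *)
Lemma ideal_right_unit (T : pred (vertex C)) : upset [pred mu : hat C k | T (vtx mu)] ->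
  exists (w : A) (g : R), [/\ w \in level A k,
    forall x, ideal T x -> x * w = g *: x
    & forall x0 x, cellspan x -> N (x * w - g *: x) -> through x0 T x].
Proof.
move=> upT; have [w [g [g0 Jw wE]]] := cideal_right_unit (murphy m k) (@regular k) upT.
exists (val w), g; split=> [|x /murphy_spanE [y Jy <-]|x0 x [f [_ Nf]] Nx].
- exact: valP.
- by rewrite -[val y * val w]/(val (y * w)) wE.
have wr := level_le le_kr (valP w); pose a : layer A r := Sub (val w) wr.
have fe : N (usum f * val a - g *: usum f).
  have -> : usum f * val a - g *: usum f
      = (x * val w - g *: x) - ((x - usum f) * val w - g *: (x - usum f)).
    by rewrite mulrBl scalerBr opprB addrA subrKA opprB addrC subrKA.
  apply: RspanD => //; apply/RspanN/RspanD; last exact/RspanN/RspanZ.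
  exact: (@murphy_above_mulr _ _ _ m _ _ _ a).
exists f; split=> // t0 nT; apply/eqP/negPn/negP => ft0.
have [phi [phiZD phi_inj _ phiM]] := murphy_cell_iso m nu.
have phi0 : phi 0 = 0.
  by have := phiZD (-1) 0 0; rewrite scaler0 addr0 scaleN1r addNr.
have phiZ c h : phi (c *: h) = c *: phi h.
  by rewrite -[c *: h]addr0 phiZD phi0 addr0.
(* w lies in an ideal for the Murphy basis; that it kills the given cell modules is
  transported along the isomorphism with the Murphy cell modules *)
have kills (mu : hat C k) : ~~ T (vtx mu) -> forall h : Delta mu,
    ract h (Sub (val w) (valP w) : layer A k) = 0.
  move=> nTmu h.
  have -> : (Sub (val w) (valP w) : layer A k) = w by apply: val_inj.
  have [psi [psiZD _ psi_onto psiM]] := murphy_cell_iso m mu.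
  have [h' <-] := psi_onto h; rewrite -psiM.
  have -> : ract (h' : cell_module (murphy m k) mu) w = 0.
    apply/ffunP => v; rewrite !ffunE big1 // => t _.
    by rewrite (ccoef_cideal (S := [pred mu : hat C k | T (vtx mu)])) ?mulr0.
  by have := psiZD (-1) 0 0; rewrite scaler0 addr0 scaleN1r addNr.
have := @cell_eigen_rank _ _ _ m coherent k T x0 (val w) g (valP w) g0 kills
  r nu a le_kr erefl.
pose good := passes k T x0 (nu := nu).
pose delta t : {ffun std_path nu -> R^o} := [ffun t' => (t' == t)%:R].
(* one vector too many: f, at None, and the basis vectors of the paths that count *)
pose v (j : option {t | good t}) : {ffun std_path nu -> R^o} :=
  if j is Some t then delta (val t) else f.
have phi_eigen (h : {ffun std_path nu -> R^o}) : N (usum h * val a - g *: usum h) ->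
    cell_eigen g a nu (phi h).
  by move=> /ract_eigen E; rewrite /cell_eigen -phiM E phiZ.
move=> /(_ _ (phi \o v)); rewrite card_option card_sig ltnn => H.
suff : false by []; apply: H => [[[t good_t]|]|b b0].
- apply: phi_eigen => /=.
  have -> : usum (delta t) = std_u u t.
    by rewrite -std_u_sum_delta; apply: eq_std_u_sum => t'; rewrite ffunE.
  have [z [_ [/murphy_spanE [y Jy <-] ->]]] := std_u_factor upT good_t.
  have yw : val y * val w = g *: val y by rewrite -[val y * val w]/(val (y * w)) wE.
  by rewrite -mulrA yw -scalerAr subrr; apply: Rspan0.
- exact: phi_eigen.
have /phi_inj/ffunP bE : phi (\sum_j b j *: v j) = 0.
  rewrite -[RHS]b0; elim/big_rec2: _ => [//|j x1 x2 _ <-]; exact: phiZD.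
have b_None : b None = 0.
  move: (bE t0); rewrite sum_ffunE (bigD1 None) //= big1 ?addr0 => [|[j|] // _].
    by rewrite !ffunE => /eqP; rewrite mulf_eq0 (negPf ft0) orbF => /eqP.
  rewrite !ffunE; case: eqP => [E|]; last by rewrite scaler0.
  by move: nT; rewrite E; have := valP j; rewrite /good => ->.
case=> [j|//]; move: (bE (val j)).
rewrite sum_ffunE (bigD1 (Some j)) //= !ffunE eqxx.
rewrite big1 ?addr0 => [|[i|] ne_i]; first by rewrite [_ *: _]mulr1.
  rewrite !ffunE; case: eqP => [E|]; last by rewrite scaler0.
  have Eji : j = i by apply: val_inj.
  by rewrite Eji eqxx in ne_i.
by rewrite !ffunE b_None scale0r.
Qed.

End RestrictionFiltration.

(** * Stability under the commuting copy *)

Section Stability.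
Variables (R : idomainType) (A : tower R) (C : cellular_tower A) (m : murphy_basis C).
Hypothesis coherent : strongly_coherent C.
Hypothesis regular : forall k (y : layer A k),
  exists (y' : layer A k) (c : R), c != 0 /\ y * y' * y = c *: y.
Variables (k r : nat) (nu : hat C r).
Hypothesis le_kr : (k <= r)%N.
Local Notation d := (down_coef m).
Local Notation u := (up_coef m).
Local Notation ideal T := (murphy_span d u [pred mu : hat C k | T (vtx mu)]).
Local Notation through x0 T := (span_on m (passes k T x0 (nu := nu))).
Local Notation cellspan := (span_on m (nu := nu) predT).

(** As b commutes with w, the element z j b is again an eigenvector of w. *)
Lemma through_mull (T : pred (vertex C)) x0 z j b :
  upset [pred mu : hat C k | T (vtx mu)] -> ideal T j ->
  {in level A k, forall y, y * b = b * y} ->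
  cellspan (z * j * b) -> through x0 T (z * j * b).
Proof.
move=> upT Jj comm_b Pzjb.
have [w [g [Lw wE wP]]] := ideal_right_unit m coherent regular nu le_kr upT.
apply: wP => //; rewrite -mulrA -comm_b // mulrA -(mulrA z) wE //.
by rewrite -scalerAr -scalerAl subrr; apply: Rspan0.
Qed.

Lemma through_commute (T : pred (vertex C)) x0 x b :
  upset [pred mu : hat C k | T (vtx mu)] -> b \in level A r ->
  {in level A k, forall y, y * b = b * y} ->
  through x0 T x -> through x0 T (x * b).
Proof.
move=> upT Lb comm_b; apply: span_on_mulr => // t Tt.
have := span_onT_mulr Lb (span_on_std_u m (isT : predT t)).
by have [z [j [Jj ->]]] := std_u_factor m le_kr upT Tt; apply: through_mull.
Qed.

Lemma through_level (T : pred (vertex C)) x0 x a :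
  upset [pred mu : hat C k | T (vtx mu)] -> a \in level A k ->
  through x0 T x -> through x0 T (x * a).
Proof.
move=> upT La; have Lra := level_le le_kr La; apply: span_on_mulr => // t Tt.
have := span_onT_mulr Lra (span_on_std_u m (isT : predT t)).
have [z [j [Jj ->]]] := std_u_factor m le_kr upT Tt.
rewrite -(mulr1 (z * j * a)) -(mulrA z j a); apply: through_mull => //.
  exact: murphy_span_mulr.
by move=> y _; rewrite mulr1 mul1r.
Qed.

Variables (la : hat C k) (tla : std_path la).
Local Notation above := (vlt (vtx la)).
Local Notation x0 := (vtx la).

Lemma vltE (mu : hat C k) : above (vtx mu) = (la < mu)%O.
Proof. by rewrite /vlt /= eqxx tagged_asE. Qed.

Lemma vleE (mu : hat C k) : vle (vtx la) (vtx mu) = (la <= mu)%O.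
Proof. by rewrite /vle /= eqxx tagged_asE. Qed.

Lemma upset_vlt : upset [pred mu : hat C k | above (vtx mu)].
Proof. by move=> mu mu'; rewrite /= !vltE; apply: lt_le_trans. Qed.

Lemma upset_vle : upset [pred mu : hat C k | vle (vtx la) (vtx mu)].
Proof. by move=> mu mu'; rewrite /= !vleE; apply: le_trans. Qed.

(** The basis vectors of the skew cell module together with those of the ideal by which
one divides. *)
Definition skew_path : pred (std_path nu) :=
  [pred t | passes k above x0 t || (take k.+1 (vertices t) == vertices tla)].

Lemma skew_pathP (t : std_path nu) :
  reflect (passes k above x0 t \/
      exists2 p, is_path (vtx la) p (vtx nu) & vertices t = vertices tla ++ p)
    (skew_path t).
Proof.
apply: (iffP orP) => -[]; [by left| |by left|].
  move=> /eqP tE; right.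
  have [mu [t' [p [pP E]]]] := std_path_split t le_kr.
  move: tE; rewrite E take_size_cat ?size_std_path // => Ett'.
  have muE : mu = la.
    by apply: vtx_inj; rewrite -[LHS](nth_std_path t' x0) Ett' nth_std_path.
  by exists p; [rewrite -muE | rewrite Ett'].
by move=> [p _ ->]; right; rewrite take_size_cat ?size_std_path.
Qed.

Lemma skew_path_std_u p : is_path (vtx la) p (vtx nu) ->
  span_on m skew_path (uprod u (vtx la) p * std_u u tla).
Proof.
move=> pP; have [t E] := std_path_cat tla pP.
rewrite -(std_u_cat u E); apply: span_on_std_u; apply/skew_pathP.
by right; exists p.
Qed.

(** Right multiplication by the projector q of the cell module of la recognises the
paths that begin with tla, and it commutes with b. *)
Lemma skew_commute x b : b \in level A r -> {in level A k, forall y, y * b = b * y} ->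
  span_on m skew_path x -> span_on m skew_path (x * b).
Proof.
move=> Lb comm_b; apply: span_on_mulr => // t.
have sub1 y : through x0 above y -> span_on m skew_path y.
  by apply: span_on_sub => t' Tt'; apply/skew_pathP; left.
case/skew_pathP => [Tt|[p pP E]].
  apply/sub1/through_commute => //; first exact: upset_vlt.
  exact: span_on_std_u.
have [q [c0 qE]] := cell_projector (murphy m k) (@regular k) tla.
set c := ccoef _ _ _ _ in c0.
have Lq := valP q; have Lrq := level_le le_kr Lq.
(* modulo labels above la, q maps the cell module of la to the line of u_tla *)
have proj (t' : std_path la) : exists2 j, ideal above j &
    std_u u t' * val q = ccoef (murphy m k) q t' tla *: std_u u tla + j.
  exists (std_u u t' * val q - ccoef (murphy m k) q t' tla *: std_u u tla); last first.
    by rewrite addrC subrK.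
  apply: (@murphy_span_sub _ _ _ m _ [pred mu | (la < mu)%O]).
    by move=> mu; rewrite /= vltE.
  have := std_u_act m t' q; congr murphy_span; congr (_ - _).
  rewrite /std_u_sum (bigD1 tla) //= big1 ?addr0 // => v ne_v.
  by rewrite qE // scale0r.
have cell_t (t2 : std_path nu) : cellspan (std_u u t2) by apply: span_on_std_u.
(* u_t b involves only paths v with v(k) >= la, so q takes it into the span *)
have le_tb : through x0 (vle (vtx la)) (std_u u t * b).
  apply: through_commute => //; first exact: upset_vle.
  by apply: span_on_std_u; rewrite /passes /= (nth_cat_std_path x0 E) vleE.
have tbq : span_on m skew_path (std_u u t * b * val q).
  apply: span_on_mulr le_tb => // t2 Tt2.
  have [mu [t' [p' [pP' E']]]] := std_path_split t2 le_kr.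
  move: Tt2; rewrite /passes /= (nth_cat_std_path x0 E') vleE le_eqVlt.
  case/orP=> [/eqP Emu|lt_mu].
    subst mu; have [j Jj jE] := proj t'.
    have := span_onT_mulr Lrq (cell_t t2).
    rewrite (std_u_cat u E') -mulrA jE mulrDr -scalerAr => Pq.
    apply: span_onD; first exact/span_onZ/skew_path_std_u.
    apply: sub1; rewrite -[_ * j]mulr1; apply: through_mull => //; first exact: upset_vlt.
      by move=> y _; rewrite mulr1 mul1r.
    rewrite mulr1; move/span_onB: Pq => /(_ (ccoef (murphy m k) q t' tla *:
      (uprod u (vtx la) p' * std_u u tla))).
    rewrite addrC addKr; apply; apply/span_onZ/(span_on_sub _ (skew_path_std_u pP')) => //.
  apply/sub1/through_level => //; first exact: upset_vlt.
  by apply: span_on_std_u; rewrite /passes /= (nth_cat_std_path x0 E') vltE.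
(* q commutes with b and scales u_tla by c, so u_t b q is c u_t b up to the ideal *)
apply: (span_on_pure c0); first exact: span_onT_mulr.
have [j Jj jE] := proj tla.
pose z := uprod u (vtx la) p.
have tE : std_u u t = z * std_u u tla by apply: std_u_cat.
have bqE : c *: (std_u u t * b) = std_u u t * b * val q - z * j * b.
  rewrite -mulrA -comm_b // mulrA tE -(mulrA z _ (val q)) jE mulrDr mulrDl addrK.
  by rewrite -scalerAr scalerAl.
have Pzjb : cellspan (z * j * b).
  have -> : z * j * b = std_u u t * b * val q - c *: (std_u u t * b).
    by rewrite bqE opprB addrC subrK.
  apply: span_onB; first by do 2![apply: span_onT_mulr => //].
  by apply/span_onZ/span_onT_mulr.
rewrite bqE; apply: span_onB => //; apply: sub1.
by apply: through_mull => //; apply: upset_vlt.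
Qed.

End Stability.

(** * The skew cell module *)

Section SkewSpans.
Variables (R : idomainType) (A : tower R) (C : cellular_tower A) (m : murphy_basis C).
Variables (s r : nat) (la : hat C (r - s)) (nu : hat C r) (tla : std_path la).
Local Notation d := (down_coef m).
Local Notation u := (up_coef m).
Local Notation N := (murphy_span d u [pred mu | (nu < mu)%O]).

Lemma span_on_ind (Q : pred (std_path nu)) (M : set A) :
  (forall a x y, M x -> M y -> M (a *: x + y)) -> (forall x, N x -> M x) ->
  (forall t, Q t -> M (std_u u t)) -> forall x, span_on m Q x -> M x.
Proof.
move=> MZD NM QM x [f [f0 Nf]].
rewrite -[x](subrK (std_u_sum m f)) -[x - _]scale1r addrC.
suff Mf : M (std_u_sum m f) by rewrite addrC; apply: MZD => //; apply: NM.
rewrite /std_u_sum; elim/big_rec: _ => [|t y _ My]; first exact/NM/Rspan0.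
by case: (boolP (Q t)) => [/QM /MZD|/f0 ->]; [apply | rewrite scale0r add0r].
Qed.

Lemma skew_idealE x :
  skew_ideal m la nu x <-> span_on m (passes (r - s) (vlt (vtx la)) (vtx la) (nu := nu)) x.
Proof.
split.
  move: x; apply: Rspan_ind; first exact: span_on0.
  move=> a x y Gx; apply: span_onZD; case: Gx => [Nx|[t [Tt ->]]].
    exact/span_on_N/Rspan_mem.
  exact: span_on_std_u.
move: x; apply: span_on_ind => [a x y|x|t Tt].
- exact: RspanZD.
- by move=> [n [a [v [vS ->]]]]; exists n, a, v; split=> // i; left; apply: vS.
by apply: Rspan_mem; right; exists t.
Qed.

Lemma skew_spanE x : skew_span m nu tla x <-> span_on m (skew_path (nu := nu) tla) x.
Proof.
have le_kr := leq_subr s r.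
split=> [[y Gy [z /skew_idealE Iz <-]]|].
  apply: span_onD; last by apply: span_on_sub Iz => t Tt; apply/skew_pathP => //; left.
  move: y Gy; apply: Rspan_ind; first exact: span_on0.
  by move=> a _ y' [p pP ->]; apply/span_onZD/skew_path_std_u.
move: x; apply: span_on_ind => [a x y [x1 Gx1 [x2 Ix2 <-]] [y1 Gy1 [y2 Iy2 <-]]|x Nx|t].
- exists (a *: x1 + y1); first exact: RspanZD.
  by exists (a *: x2 + y2); [apply: RspanZD | rewrite scalerDr addrACA].
- exists 0; first exact: Rspan0.
  by exists x; rewrite ?add0r //; apply/skew_idealE/span_on_N.
case/skew_pathP => // [Tt|[p pP E]].
  exists 0; first exact: Rspan0.
  by exists (std_u u t); rewrite ?add0r //; apply/skew_idealE/span_on_std_u.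
exists (std_u u t); last by exists 0; rewrite ?addr0 //; apply: Rspan0.
by apply: Rspan_mem; exists p; rewrite // (std_u_cat u E).
Qed.

End SkewSpans.

Lemma one_times_level (R : idomainType) (A : tower R) (P : outer_products A) s r
    (le_sr : (s <= r)%N) (a : layer A s) : one_times P le_sr a \in level A r.
Proof. exact: valP. Qed.

Lemma one_times_comm (R : idomainType) (A : tower R) (P : outer_products A) s r
    (le_sr : (s <= r)%N) (a : layer A s) :
  {in level A (r - s), forall y, y * one_times P le_sr a = one_times P le_sr a * y}.
Proof.
move=> y Ly; rewrite -[y]/(val (Sub y Ly : layer A (r - s))) -(outer_incl P le_sr).
by rewrite /one_times -!rmorphM te_comm.
Qed.

Theorem theorem4p2 (R : idomainType) (A H : tower R)
    (CA : cellular_tower A) (CH : cellular_tower H) (e : nat -> A) (L : nat -> A)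
    (P : outer_products A) (m : murphy_basis CA)
    (hdiagram : diagram_tower CA CH e)
    (hcoherent : strongly_coherent CA)
    (hJM : jucys_murphy CA L)
    (s r : nat) (le_sr : (s <= r)%N) (la : hat CA (r - s)) (nu : hat CA r)
    (tla : std_path la) (htla : dominance_maximal tla) :
  exists (D : lmodType (layer A s)^c) (pi : A -> D),
    subquotient_iso (fun (x : A) (a : layer A s) => x * one_times P le_sr a)
      (@ract _ D) (skew_span m nu tla) (skew_ideal m la nu) pi.
Proof.
have regular k (y : layer A k) : exists (y' : layer A k) (c : R),
    c != 0 /\ y * y' * y = c *: y.
  exact: regular_up_to_scalar (cbas_basis (cells CA k)) (dt_semisimple hdiagram k) y.
have le_kr := leq_subr s r.
apply: subquotient_exists.
- move=> x /skew_idealE Ix; apply/skew_spanE; apply: span_on_sub Ix => t Tt.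
  by apply/skew_pathP => //; left.
- exact: Rspan0.
- by move=> x y Ix Iy; apply: RspanD => //; apply: RspanN.
- by move=> x y /skew_spanE Sx /skew_spanE Sy; apply/skew_spanE/span_onB.
- move=> x a /skew_idealE Ix; apply/skew_idealE/through_commute => //.
  + exact: upset_vlt.
  + exact: one_times_level.
  + exact: one_times_comm.
- move=> x a /skew_spanE Sx; apply/skew_spanE/skew_commute => //.
  + exact: one_times_level.
  + exact: one_times_comm.
- by move=> a x y; rewrite mulrDl.
- by move=> x a b; rewrite /one_times !raddfD /= mulrDr.
- by move=> x; rewrite /one_times !rmorph1 mulr1.
by move=> x a b; rewrite /one_times !rmorphM mulrA.
Qed.
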